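(* Let $(X,d,\mu)$ be a space of homogeneous type. Given $0\leq\eta<1$, let $p(\cdot):X\to[1,\infty]$ be a measurable function such that $1/p(\cdot)\in LH$ and $1<p_-\leq p_+\leq 1/\eta$. Define $q(\cdot)$ pointwise by $1/p(x)-1/q(x)=\eta$ for each $x\in X$. Then there exists a constant $C=C(p(\cdot),\eta,X)$ such that for all $f\in L^{p(\cdot)}(X)$, $$\|M_\eta f\|_{q(\cdot)}\leq C\|f\|_{p(\cdot)}.$$ Moreover, if $\mu(X)<+\infty$, then the hypothesis $1/p(\cdot)\in LH$ can be replaced by $1/p(\cdot)\in LH_0$.
   Context: Conventions: $1/\infty=0$ and $1/0=\infty$. A quasi-metric space $(X,d)$ is a set $X$ with $d:X\times X\to[0,\infty)$ such that $d(x,y)=0$ iff $x=y$, $d(x,y)=d(y,x)$, and $d(x,y)\le A_0(d(x,z)+d(y,z))$ for all $x,y,z$ and some constant $A_0\ge1$. Write $B(x,r)$ for the ball with center $x$ and radius $r>0$. $(X,d,\mu)$ is a space of homogeneous type if $(X,d)$ is a quasi-metric space, $\mu$ is a positive measure defined on the $\sigma$-algebra generated by quasi-metric balls and open sets, $0<\mu(B)<\infty$ for every ball $B$, and there is $C_\mu\ge1$ with $\mu(B(x,2r))\le C_\mu\,\mu(B(x,r))$ for all $x\in X$, $r>0$. Fractional maximal operator: for $0\le\eta<1$, $$M_\eta f(x)=\sup_{B\ni x}\mu(B)^{\eta}\,\frac1{\mu(B)}\int_B|f|\,d\mu,$$ the supremum being over all balls $B$ containing $x$. Variable Lebesgue spaces: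 for measurable $p(\cdot):X\to[1,\infty]$ let $\Omega_\infty^{p(\cdot)}=\{x\in X:p(x)=\infty\}$ and $$\rho_{p(\cdot)}(f)=\int_{X\setminus\Omega_\infty^{p(\cdot)}}|f(x)|^{p(x)}\,d\mu(x)+\|f\|_{L^\infty(\Omega_\infty^{p(\cdot)})}.$$ $L^{p(\cdot)}(X)$ is the set of measurable $f$ with $\rho_{p(\cdot)}(f/\lambda)<\infty$ for some $\lambda>0$, with norm $\|f\|_{p(\cdot)}=\inf\{\lambda>0:\rho_{p(\cdot)}(f/\lambda)\le1\}$. Put $p_-=\operatorname{ess\,inf}_{x\in X}p(x)$ and $p_+=\operatorname{ess\,sup}_{x\in X}p(x)$. Log-Hölder conditions: for $r(\cdot):X\to[0,\infty)$, $r(\cdot)\in LH_0$ if there is $C_0$ with $|r(x)-r(y)|\le \frac{-C_0}{\log d(x,y)}$ for all $x\neq y$ in $X$ with $d(x,y)<1/2$. $r(\cdot)\in LH_\infty$ (with respect to a base point $x_0\in X$; the choice of base point is immaterial up to changing the constant) if there are constants $C_\infty,r_\infty$ with $|r(x)-r_\infty|\le\frac{C_\infty}{\log(e+d(x,x_0))}$ for all $x\in X$. $LH=LH_0\cap LH_\infty$. *)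

(* Defs.v *)
From HB Require Import structures.
From mathcomp Require Import all_boot all_order all_algebra.
From mathcomp Require Import all_classical all_reals all_analysis.
From mathcomp Require Import measurable_realfun ess_sup_inf.

Set Implicit Arguments.
Unset Strict Implicit.
Unset Printing Implicit Defensive.

Import Order.TTheory GRing.Theory Num.Theory.
Import numFieldNormedType.Exports.

Local Open Scope classical_set_scope.
Local Open Scope ring_scope.

Section QuasiMetric.
Context {R : realType} {X : Type}.
Variable d : X -> X -> R.

Definition quasi_metric : Prop :=
  [/\ forall x y, 0 <= d x y,
      forall x y, d x y = 0 <-> x = y,
      forall x y, d x y = d y x
    & exists2 A0 : R, 1 <= A0 &
        forall x y z, d x y <= A0 * (d x z + d y z)].

Definition qball (x : X) (r : R) : set X := [set y | d x y < r].

Definition qballs : set (set X) :=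
  [set B | exists x r, 0 < r /\ B = qball x r].

(* The topology of d. For a quasi-metric a ball need not be open, which is why
   the sigma-algebra below is generated by the balls and the open sets. *)
Definition qopens : set (set X) :=
  [set U | forall x, U x -> exists2 r : R, 0 < r & qball x r `<=` U].

Definition LH0 (r : X -> R) : Prop :=
  exists C0 : R, forall x y, x <> y -> d x y < 1 / 2 ->
    `|r x - r y| <= - C0 / ln (d x y).

Definition LH_infty (x0 : X) (r : X -> R) : Prop :=
  exists Cinfty rinfty : R, forall x,
    `|r x - rinfty| <= Cinfty / ln (expR 1 + d x x0).

Definition LH (x0 : X) (r : X -> R) : Prop := LH0 r /\ LH_infty x0 r.

End QuasiMetric.

Section VariableLebesgue.
Context {R : realType} {disp : measure_display} {X : measurableType disp}.
Variables (d : X -> X -> R) (mu : {measure set X -> \bar R}).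
Local Open Scope ereal_scope.

Record homogeneous_type : Prop := HomogeneousType {
  homogeneous_quasi_metric : quasi_metric d ;
  homogeneous_measurable :
    @measurable disp X = <<s qballs d `|` qopens d >> ;
  homogeneous_ball : forall B, qballs d B -> 0 < mu B < +oo ;
  homogeneous_doubling : exists2 Cmu : R, (1 <= Cmu)%R &
    forall x r, (0 < r)%R -> mu (qball d x (2 * r)) <= Cmu%:E * mu (qball d x r)
}.

Definition frac_maximal (eta : R) (f : X -> \bar R) (x : X) : \bar R :=
  ereal_sup [set mu B `^ eta * ((mu B)^-1 * \int[mu]_(y in B) `|f y|)
            | B in [set B | qballs d B /\ B x]].

Definition Omega_infty (p : X -> \bar R) : set X := [set x | p x = +oo].

(* The L^infty norm over Omega_infty is that of the extension by zero [f \_ _];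
   it is 0 if Omega_infty is negligible. *)
Definition modular (p f : X -> \bar R) : \bar R :=
  \int[mu]_(x in ~` Omega_infty p) (`|f x| `^ fine (p x))
  + 'N[mu]_+oo [f \_ (Omega_infty p)].

Definition scale_inv (f : X -> \bar R) (lambda : R) (x : X) : \bar R :=
  f x / lambda%:E.

Definition var_Lp (p : X -> \bar R) : set (X -> \bar R) :=
  [set f : X -> \bar R | measurable_fun setT f /\
     exists2 lambda : R, (0 < lambda)%R & modular p (scale_inv f lambda) < +oo].

Definition var_norm (p f : X -> \bar R) : \bar R :=
  ereal_inf [set lambda%:E | lambda in
    [set lambda : R | (0 < lambda)%R /\ modular p (scale_inv f lambda) <= 1]].

End VariableLebesgue.

(* Main.v *)
(* Write r = 1/p, s = 1/q = r - eta, and normalise |f| <= F^r with F >= 0 and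
   int F <= 1; this form also covers r = 0, that is p = oo. Fix P in ]1, p_-]
   and an integrable weight w(x) = (e + d(x,x0))^-N, and put
   H = F^(1/P) + w^(1/P), a function with bounded L^P norm. For a ball B
   containing x let a be the average of H over B, so that a^P mu(B) is bounded.
   - If a >= 1, LH_0 and LH_oo together bound mu(B)^-|r(x)-r(y)| for y in B, so
     that in F^r = (F^(1/P))^(P r) the exponent r(y) can be frozen at r(x).
   - If a < 1, the inequality H >= w^(1/P) and LH_oo allow replacing r(y) by
     r_oo, and r_oo by r(x) once w(x)^(1/P) is added to a.
   The exponents P r lie in [0, 1], so no Jensen inequality is needed, and the
   factor mu(B)^eta is absorbed by a^(-P eta). Hence
     M_eta f(x) <= C ((MH(x))^P + w(x))^s(x),
   and one concludes by the L^P boundedness of the maximal operator M, which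
   follows from a greedy covering argument and a dyadic layer-cake sum. *)

Require Import Defs.
From HB Require Import structures.
From mathcomp Require Import all_boot all_order all_algebra.
From mathcomp Require Import all_classical all_reals all_analysis.
From mathcomp Require Import measurable_realfun ess_sup_inf.
From mathcomp Require Import ring lra.

Set Implicit Arguments.
Unset Strict Implicit.
Unset Printing Implicit Defensive.

Import Order.TTheory GRing.Theory Num.Theory.
Import numFieldNormedType.Exports.

Local Open Scope classical_set_scope.
Local Open Scope ring_scope.
Local Open Scope ereal_scope.

(** * Doubling and engulfing *)

Section HomogeneousType.
Context {R : realType} {disp : measure_display} {X : measurableType disp}.
Variables (d : X -> X -> R) (mu : {measure set X -> \bar R}).
Hypothesis hX : homogeneous_type d mu.

(** Balls need not be open, so [MH] and [M_eta f] may fail to be measurable and their superlevel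
    sets are avoided. Each maximal estimate is stated through a measurable majorant instead: a set
    [U] containing all balls of large average, a function [W] above [a^P] for every average [a] at a
    point, and finally [Y], comparable to [W + w].

    The weight serves twice. It makes [H] strictly positive, so that every average [a] is positive
    and can be raised to negative powers, and it keeps the base of a power away from 0 when
    exponents are compared with [r_oo]. Working with [r = 1/p] confines the exponents to the bounded
    interval [[eta, 1/P]]. Since every ball has positive measure, [LH0] turns the essential bounds
    on [p] into pointwise ones, and the exponent can be frozen at an arbitrary point. *)

Lemma qd_ge0 x y : (0 <= d x y)%R.
Proof. by have [+ _ _ _] := homogeneous_quasi_metric hX; exact. Qed.

Lemma qdxx x : d x x = 0%R.
Proof. by have [_ + _ _] := homogeneous_quasi_metric hX => h; apply/h. Qed.

Lemma qd_sym x y : d x y = d y x.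
Proof. by have [_ _ + _] := homogeneous_quasi_metric hX; exact. Qed.

Lemma qd_triangle : exists2 A : R, (1 <= A)%R &
  forall x y z, (d x y <= A * (d x z + d y z))%R.
Proof. by have [] := homogeneous_quasi_metric hX. Qed.

Lemma qballs_qball x r : (0 < r)%R -> qballs d (qball d x r).
Proof. by move=> r0; exists x, r. Qed.

Lemma qball_center x r : (0 < r)%R -> qball d x r x.
Proof. by move=> r0; rewrite /qball/= qdxx. Qed.

Lemma subset_qball x r s : (r <= s)%R -> qball d x r `<=` qball d x s.
Proof. by move=> rs y /lt_le_trans; apply. Qed.

Lemma measurable_qballs B : qballs d B -> measurable B.
Proof.
by move=> dB; rewrite (homogeneous_measurable hX); apply: sub_sigma_algebra; left.
Qed.

Lemma measurable_qball x r : measurable (qball d x r).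
Proof.
have [r0|r0] := ltP 0%R r; first exact/measurable_qballs/qballs_qball.
rewrite (_ : qball d x r = set0)//; apply/seteqP; split=> // y.
by rewrite /qball/= ltNge (le_trans r0 (qd_ge0 _ _)).
Qed.

Lemma measurable_qd x : measurable_fun setT (d x).
Proof.
apply: (measurability _ (RGenInftyO.measurableE R)).
move=> _ [_ [a ->] <-]; rewrite setTI.
rewrite [X in measurable X](_ : _ = qball d x a); first exact: measurable_qball.
by apply/seteqP; split => y; rewrite /= in_itv.
Qed.

Definition vol B := fine (mu B).

Lemma volE B : qballs d B -> mu B = (vol B)%:E.
Proof.
by move=> /(homogeneous_ball hX)/andP[m0 mi]; rewrite fineK// ge0_fin_numE.
Qed.

Lemma vol_gt0 B : qballs d B -> (0 < vol B)%R.
Proof.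
by move=> dB; have /andP[] := homogeneous_ball hX dB; rewrite volE.
Qed.

Lemma doubling_iter : exists2 C : R, (1 <= C)%R & forall n x r, (0 < r)%R ->
  (vol (qball d x (2 ^+ n * r)) <= C ^+ n * vol (qball d x r))%R.
Proof.
have [C C1 dbl] := homogeneous_doubling hX.
exists C => //; elim=> [|n ih] x r r0; first by rewrite !expr0 !mul1r.
have r20 : (0 < 2 ^+ n * r)%R by rewrite mulr_gt0// exprn_gt0.
have := dbl x _ r20; rewrite !volE; try exact: qballs_qball.
  rewrite -EFinM lee_fin mulrA -exprS => /le_trans; apply.
  by rewrite exprS -mulrA ler_wpM2l ?ih// (le_trans _ C1).
by apply: qballs_qball; rewrite mulr_gt0.
Qed.

Lemma le_vol A B : qballs d A -> qballs d B -> A `<=` B -> (vol A <= vol B)%R.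
Proof.
move=> dA dB AB; rewrite -lee_fin -!volE//.
by apply: le_measure => //; rewrite inE; exact: measurable_qballs.
Qed.

Lemma exists_pow2 (K : R) : exists n, (K <= 2 ^+ n)%R.
Proof.
have [k Kk] : exists k : nat, (K < k%:R)%R.
  by exists (Num.truncn K).+1; exact: Num.Theory.truncnS_gt.
by exists k; rewrite (le_trans (ltW Kk))// -natrX ler_nat ltnW// ltn_expl.
Qed.

Lemma doubling_dilate (K : R) : exists2 C : R, (1 <= C)%R & forall x r,
  (0 < r)%R -> (0 < K)%R -> (vol (qball d x (K * r)) <= C * vol (qball d x r))%R.
Proof.
have [C C1 dbl] := doubling_iter; have [n Kn] := exists_pow2 K.
exists (C ^+ n)%R; first exact: exprn_ege1.
move=> x r r0 K0; apply: le_trans (dbl n x r r0).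
apply: le_vol; try by apply: qballs_qball; rewrite mulr_gt0// exprn_gt0.
by apply: subset_qball; rewrite ler_pM2r.
Qed.

End HomogeneousType.

Section Engulfing.
Context {R : realType} {disp : measure_display} {X : measurableType disp}.
Variables (d : X -> X -> R) (mu : {measure set X -> \bar R}).
Hypothesis hX : homogeneous_type d mu.

Lemma bigcup_qball c : \bigcup_n qball d c n.+1%:R = setT.
Proof.
apply/seteqP; split=> // y _; exists (Num.truncn (d c y)) => //.
exact: Num.Theory.truncnS_gt.
Qed.

Lemma le_mu_setT c (M : \bar R) :
  (forall n, mu (qball d c n.+1%:R) <= M) -> mu setT <= M.
Proof.
move=> cM; rewrite -(bigcup_qball c).
have h : mu (qball d c n.+1%:R) @[n --> \oo] --> mu (\bigcup_n qball d c n.+1%:R).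
  apply: (@nondecreasing_cvg_mu _ _ _ mu (fun n => qball d c n.+1%:R)).
  - by move=> n; exact: (measurable_qball hX).
  - by apply: bigcup_measurable => n _; exact: (measurable_qball hX).
  - move=> m n mn; apply/subsetPset; apply: subset_qball.
    by rewrite ler_nat ltnS.
rewrite -(cvg_lim _ h)//; apply: lime_le; first by apply/cvg_ex; eexists; exact: h.
exact: nearW.
Qed.

(** A ball of radius at most [rho] is handled by doubling around [c]. For a larger radius [s], the
    enlarged ball around [c] lies in a dilate of [B], so its measure is controlled by that of [B];
    this is where the comparison of measures enters. *)
Lemma ball_in_concentric : exists2 K : R, (1 <= K)%R &
  forall c rho, (0 < rho)%R -> forall B, qballs d B ->
    B `&` qball d c rho !=set0 ->
    (vol mu B <= 2 * vol mu (qball d c rho))%R ->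
    exists r, [/\ (0 < r)%R, B `<=` qball d c r &
      (vol mu (qball d c r) <= K * vol mu (qball d c rho))%R].
Proof.
have [A A1 tri] := qd_triangle hX.
have A0 : (0 < A)%R by exact: lt_le_trans A1.
pose k := (3 * A ^+ 2)%R; pose k' := (A * (1 + A * (k + 1)))%R.
have k0 : (0 < k)%R by rewrite mulr_gt0 ?exprn_gt0.
have k'0 : (0 < k')%R by rewrite /k' mulr_gt0// addr_gt0// mulr_gt0// addr_gt0.
have [C1 C11 dil1] := doubling_dilate hX k'.
have [C2 C21 dil2] := doubling_dilate hX k.
exists (2 * C1 + C2)%R; first lra.
move=> c rho rho0 _ [z [s [s0 ->]]] [w [/= zw cw]] mB.
rewrite /qball/= in zw cw.
pose t := Num.max rho s.
have st : (s <= t)%R by rewrite /t le_max lexx orbT.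
have rt : (rho <= t)%R by rewrite /t le_max lexx.
have t0 : (0 < t)%R by exact: lt_le_trans rt.
exists (k * t)%R; split; first by rewrite mulr_gt0.
  move=> y; rewrite /qball/= => zy.
  have h1 := tri c y w; have h2 := tri y w z.
  rewrite (qd_sym hX y z) (qd_sym hX w z) in h2.
  have h3 : (A * (d z y + d z w) <= A * (2 * t))%R by rewrite ler_pM2l//; lra.
  have h4 : (A * (d c w + d y w) < A * (t + A * (2 * t)))%R.
    by rewrite ltr_pM2l//; lra.
  have h5 : (A * t <= A * (A * t))%R by rewrite ler_pM2l// ler_peMl// ltW.
  by rewrite /k; lra.
have [ts|ts] := leP s rho.
  have -> : t = rho by apply: max_idPl.
  rewrite (le_trans (dil2 _ _ rho0 k0))// ler_pM2r; first lra.
  by apply: (vol_gt0 hX); exact: qballs_qball.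
have tE : t = s by apply: max_idPr; exact: ltW.
apply: (@le_trans _ _ (vol mu (qball d z (k' * s)))).
  apply: (le_vol hX).
  - by apply: qballs_qball; rewrite mulr_gt0.
  - by apply: qballs_qball; rewrite mulr_gt0.
  move=> y; rewrite /qball/= tE => cy.
  have h1 := tri z y w; have h2 := tri y w c.
  rewrite (qd_sym hX y c) (qd_sym hX w c) in h2.
  have h3 : (A * (d c y + d c w) < A * (k * s + s))%R by rewrite ltr_pM2l//; lra.
  have h4 : (A * (d z w + d y w) < A * (s + A * (k * s + s)))%R.
    by rewrite ltr_pM2l//; lra.
  by rewrite /k'; lra.
rewrite (le_trans (dil1 _ _ s0 k'0))//.
have vr : (0 < vol mu (qball d c rho))%R.
  by apply: (vol_gt0 hX); exact: qballs_qball.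
have : (C1 * vol mu (qball d z s) <= C1 * (2 * vol mu (qball d c rho)))%R.
  by rewrite ler_pM2l//; exact: lt_le_trans C11.
have : (0 <= C2 * vol mu (qball d c rho))%R.
  by rewrite mulr_ge0//; [exact: le_trans C21|exact: ltW].
lra.
Qed.

(* Comparing balls by measure rather than by radius makes the covering argument
   work without any bound on the radii. *)
Lemma engulf : exists2 K : R, (1 <= K)%R & forall C, qballs d C ->
  exists V, [/\ measurable V, mu V <= (K * vol mu C)%:E &
    forall B, qballs d B -> B `&` C !=set0 -> (vol mu B <= 2 * vol mu C)%R ->
      B `<=` V].
Proof.
have [K K1 conc] := ball_in_concentric.
have [C2 C21 dil2] := doubling_dilate hX 2.
have K0 : (0 < K)%R by exact: lt_le_trans K1.
exists (C2 * K)%R; first by rewrite -[1%R]mulr1 ler_pM.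
move=> _ [c [rho [rho0 ->]]].
have v0 : (0 < vol mu (qball d c rho))%R.
  by apply: (vol_gt0 hX); exact: qballs_qball.
(* The ball of radius [sup S] about [c] contains every ball provided by [conc]; one doubling from a
   radius in [S] above [sup S / 2] bounds its measure. If [S] is unbounded, [X] itself has
   comparable measure. *)
pose S := [set r | (0 < r)%R /\
  (vol mu (qball d c r) <= K * vol mu (qball d c rho))%R].
have Srho : S rho by split=> //; rewrite ler_peMl// ltW.
have [ubS|ubS] := pselect (has_ubound S); last first.
  exists setT; split=> //.
  apply: (le_mu_setT (c := c)) => n.
  have [s [s0 Ss] ns] : exists2 s, S s & (n.+1%:R < s)%R.
    apply: contrapT => h; apply: ubS; exists n.+1%:R => s Ss.
    by rewrite leNgt; apply/negP => ns; apply: h; exists s.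
  rewrite (volE hX); last exact: qballs_qball.
  rewrite lee_fin (@le_trans _ _ (vol mu (qball d c s)))//.
    apply: (le_vol hX); [exact: qballs_qball|exact: qballs_qball|].
    exact/subset_qball/ltW.
  by rewrite (le_trans Ss)// -mulrA ler_peMl// mulr_ge0// ltW.
have supS : has_sup S by split; [exists rho|].
have s0 : (0 < sup S)%R by rewrite (lt_le_trans rho0)//; exact: ub_le_sup.
exists (qball d c (sup S)); split.
- exact: (measurable_qball hX).
- have [e [e0 Se] he] : exists2 e, S e & (sup S / 2 < e)%R.
    have h : (0 < sup S / 2)%R by lra.
    have [e Se he] := sup_adherent h supS.
    by exists e => //; lra.
  rewrite (volE hX); last exact: qballs_qball.
  rewrite lee_fin -[X in qball d c X](@mulfVK _ 2%R)// mulrC.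
  rewrite (le_trans (dil2 _ _ _ _))//; first lra.
  rewrite -mulrA ler_pM2l; last exact: lt_le_trans C21.
  apply: le_trans Se; apply: (le_vol hX).
  + by apply: qballs_qball; lra.
  + exact: qballs_qball.
  + by apply: subset_qball; lra.
- move=> B dB BC vB; have [r [r0 Br vr]] := conc _ _ rho0 _ dB BC vB.
  by apply: (subset_trans Br); apply: subset_qball; exact: ub_le_sup.
Qed.

End Engulfing.

(** * The maximal operator on L^P *)

(** Each stage picks a member of [F] disjoint from the earlier choices, with [v] above half the
    supremum over such members, or the empty set if there are none. The first chosen set that [B]
    meets was picked while [B] was still a candidate, whence the factor 2. If [B] meets none, it
    remains a candidate forever, which is the second alternative. *)
Lemma greedy_selection {R : realType} (T : Type) (v : set T -> R)
    (F : set (set T)) (M : R) :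
  (forall B, F B -> (0 < v B <= M)%R) ->
  exists C : nat -> set T, [/\ forall n, C n = set0 \/ F (C n),
    trivIset setT C &
    forall B, F B -> (exists2 n, B `&` C n !=set0 & (v B <= 2 * v (C n))%R) \/
                     (forall n, v B <= 2 * v (C n))%R].
Proof.
move=> FM.
have /choice[next nextP] : forall U : set T, exists C, [/\ C = set0 \/ F C,
    C `&` U = set0 & forall B, F B -> B `&` U = set0 -> (v B <= 2 * v C)%R].
  move=> U; pose S := [set r | exists B, [/\ F B, B `&` U = set0 & v B = r]].
  have [[r0 Sr0]|S0] := pselect (exists r, S r); last first.
    exists set0; split; [by left|by rewrite set0I|] => B FB BU.
    by exfalso; apply: S0; exists (v B), B.
  have supS : has_sup S.
    by split; [exists r0|exists M => _ [B [/FM/andP[_ ?] _ <-]]].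
  have S0 : (0 < sup S)%R.
    rewrite (@lt_le_trans _ _ r0)//; last exact: (ub_le_sup supS.2).
    by case: Sr0 => B [/FM/andP[+ _] _ <-].
  have h : (0 < sup S / 2)%R by lra.
  have [_ [C [FC CU <-]] Ch] := sup_adherent h supS.
  exists C; split=> //; [by right|] => B FB BU.
  have /(ub_le_sup supS.2) : S (v B) by exists B.
  lra.
pose U n := iter n (fun U => U `|` next U) set0.
pose C n := next (U n).
have CU m n : (m < n)%N -> C m `<=` U n.
  elim: n => // n ih; rewrite ltnS leq_eqVlt => /predU1P[->|/ih mn].
    by move=> x Cx; right.
  by move=> x /mn Cx; left.
exists C; split.
- by move=> n; have [] := nextP (U n).
- apply: ltn_trivIset => n m mn; have [_ CnU _] := nextP (U n).
  by rewrite -subset0 -CnU => x [/(CU _ _ mn) Ux Cx].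
move=> B FB.
have meet n : B `&` U n !=set0 ->
    exists2 n, B `&` C n !=set0 & (v B <= 2 * v (C n))%R.
  elim: n => [[x []]//|n ih [x [Bx UCx]]].
  have [BU|BU] := eqVneq (B `&` U n) set0; last exact/ih/set0P.
  case: UCx => [Ux|Cx]; first by have : (B `&` U n) x by []; rewrite BU.
  by exists n; [exists x|have [_ _] := nextP (U n); apply].
have [[n BU]|nBU] := pselect (exists n, B `&` U n !=set0).
  by left; exact: meet BU.
right => n; have [_ _] := nextP (U n); apply => //.
by apply/eqP/negPn/negP => /set0P BU; apply: nBU; exists n.
Qed.

Section MaximalFunction.
Context {R : realType} {disp : measure_display} {X : measurableType disp}.
Variables (d : X -> X -> R) (mu : {measure set X -> \bar R}).
Hypothesis hX : homogeneous_type d mu.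

(** Vitali covering: the greedy balls [C n] are disjoint, so [l] times their total volume is at most
    the integral of [h], and their engulfing sets cover all balls of average above [l]. The
    measurable [U] stands in for the superlevel set of the maximal function. *)
Lemma weak_type : exists2 K : R, (1 <= K)%R &
  forall h : X -> \bar R, measurable_fun setT h -> (forall x, 0 <= h x) ->
  forall l : R, (0 < l)%R -> exists U, [/\ measurable U,
    forall B, qballs d B -> l%:E * mu B < \int[mu]_(x in B) h x -> B `<=` U &
    l%:E * mu U <= K%:E * \int[mu]_x h x].
Proof.
have [K K1 eng] := engulf hX; exists K => // h mh h0 l l0.
have K0 : (0 < K)%R by exact: lt_le_trans K1.
have I0 : 0 <= \int[mu]_x h x by exact: integral_ge0.
have [Iy|Ify] := eqVneq (\int[mu]_x h x) +oo.
  by exists setT; split=> //; rewrite Iy gt0_muley ?lte_fin// leey.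
have If : \int[mu]_x h x \is a fin_num by rewrite ge0_fin_numE// ltey.
pose I := fine (\int[mu]_x h x).
have IE : \int[mu]_x h x = I%:E by rewrite fineK.
pose F := [set B | qballs d B /\ l%:E * mu B < \int[mu]_(x in B) h x].
have FI B : F B -> (0 < vol mu B <= I / l)%R.
  move=> [dB lB]; rewrite (vol_gt0 hX)//= ler_pdivlMr// mulrC -lee_fin EFinM.
  rewrite -(volE hX)// (le_trans (ltW lB))// -IE.
  apply: ge0_subset_integral => //; exact: (measurable_qballs hX).
have [C [CF tC CB]] := greedy_selection FI.
have mC n : measurable (C n).
  by have [->//|[/(measurable_qballs hX)]] := CF n.
have vC0 n : (0 <= vol mu (C n))%R by rewrite fine_ge0.
have vCE n : mu (C n) = (vol mu (C n))%:E.
  by have [->|[/(volE hX)]//] := CF n; rewrite /vol measure0.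
have lC n : (l * vol mu (C n))%:E <= \int[mu]_(x in C n) h x.
  rewrite EFinM -vCE; have [->|[_ /ltW//]] := CF n.
  by rewrite measure0 mule0 integral_ge0.
have sumC : l%:E * \sum_(n <oo) (vol mu (C n))%:E <= I%:E.
  rewrite -nneseriesZl//; last by move=> n _; rewrite lee_fin.
  apply: (@le_trans _ _ (\sum_(n <oo) \int[mu]_(x in C n) h x)).
    apply: lee_nneseries => [n _ _|n _]; last exact: lC.
    by rewrite -EFinM lee_fin mulr_ge0// ltW.
  rewrite -ge0_integral_bigcup//; last by apply: measurable_funTS.
  rewrite -IE; apply: ge0_subset_integral => //.
  exact: bigcup_measurable.
have CB' B : F B -> exists2 n, B `&` C n !=set0 & (vol mu B <= 2 * vol mu (C n))%R.
  (* In the other alternative every [C n] has at least half the volume of [B], and finitely many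
     terms already violate [sumC]. *)
  move=> FB; have [//|vB] := CB _ FB; exfalso.
  have /andP[vB0 _] := FI _ FB.
  have lB0 : (0 < l * vol mu B)%R by rewrite mulr_gt0.
  pose n := (Num.truncn (2 * I / (l * vol mu B))).+1.
  have nE : (2 * I < n%:R * (l * vol mu B))%R.
    by rewrite -ltr_pdivrMr//; exact: Num.Theory.truncnS_gt.
  have : l%:E * (\sum_(0 <= i < n) (vol mu (C i))%:E) <= I%:E.
    apply: le_trans sumC; rewrite lee_pmul2l//.
    by apply: nneseries_lim_ge => i _ _; rewrite lee_fin.
  rewrite sumEFin -EFinM lee_fin leNgt => /negP; apply.
  apply: (@lt_le_trans _ _ (l * (\sum_(0 <= i < n) (vol mu B / 2))))%R.
    rewrite big_const_nat subn0 iter_addr_0 -mulr_natl; lra.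
  rewrite ler_pM2l//; apply: ler_sum => i _.
  by have := vB i; lra.
have /choice[V VP] : forall n, exists V, [/\ measurable V,
    mu V <= (K * vol mu (C n))%:E &
    forall B, qballs d B -> B `&` C n !=set0 ->
      (vol mu B <= 2 * vol mu (C n))%R -> B `<=` V].
  move=> n; have [->|[dC _]] := CF n; last exact: eng.
  exists set0; rewrite /vol measure0 mulr0; split=> //.
  by move=> B _ [x []].
have mV n : measurable (V n) by have [] := VP n.
have mUV : measurable (\bigcup_n V n) by exact: bigcup_measurable.
exists (\bigcup_n V n); split => //.
  move=> B dB lB; have [n BC vB] := CB' _ (conj dB lB).
  have [_ _ /(_ _ dB BC vB) BV] := VP n.
  by move=> x /BV Vx; exists n.
have mUK : mu (\bigcup_n V n) <= K%:E * \sum_(n <oo) (vol mu (C n))%:E.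
  apply: le_trans (generalized_Boole_inequality _ _ _) _ => //.
  rewrite -nneseriesZl//; last by move=> n _; rewrite lee_fin.
  apply: lee_nneseries => // n _; rewrite -EFinM; by have [] := VP n.
apply: (@le_trans _ _ (l%:E * (K%:E * \sum_(n <oo) (vol mu (C n))%:E))).
  by rewrite lee_pmul2l.
by rewrite muleCA IE lee_pmul2l.
Qed.

End MaximalFunction.

(** * Dyadic layer-cake sums *)

Section DyadicSum.
Context {R : realType}.
Local Open Scope ring_scope.
Implicit Types (P t u a c : R).

Definition tail c u : R := if c < u then u else 0.

Lemma tail_ge0 c u : 0 <= u -> 0 <= tail c u.
Proof. by rewrite /tail; case: ifP. Qed.

Lemma ln2_gt0 : 0 < ln 2 :> R.
Proof. by rewrite ln_gt0// ltr1n. Qed.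

Lemma ltr_powR2 (s t : R) : (2 `^ s < 2 `^ t) = (s < t).
Proof. by rewrite /powR pnatr_eq0/= ltr_expR ltr_pM2r ?ln2_gt0. Qed.

Lemma dyadic_bracket a : 0 < a ->
  exists k : int, 2 `^ k%:~R < a <= 2 `^ (k%:~R + 1).
Proof.
move=> a0; pose y := ln a / ln 2.
have aE : a = 2 `^ y.
  by rewrite /powR pnatr_eq0/= /y divfK ?gt_eqF ?ln2_gt0// lnK.
exists (Num.ceil y - 1).
have /andP[y1 y2] := Num.Theory.ceil_itv y.
rewrite {1 2}aE ltr_powR2 leNgt ltr_powR2 -leNgt; apply/andP; split=> //.
by rewrite rmorphB/= subrK.
Qed.

(* A term of the geometric series is a difference of consecutive values of the
   series truncated at height [u], so that sums of such terms telescope. *)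
Let m P u t := Num.min (2 `^ ((P - 1) * t)) (2 `^ (2 * (P - 1)) * u `^ (P - 1)).

Lemma dyadic_term P u t : 1 < P -> 0 <= u ->
  (2 `^ (P - 1) - 1) * (2 `^ ((P - 1) * t) * tail (2 `^ (t - 1)) u) <=
  (m P u (t + 1) - m P u t) * u.
Proof.
move=> P1 u0; rewrite /tail; case: ifPn => tu; last first.
  rewrite !mulr0 mulr_ge0// subr_ge0 /m le_min !ge_min lexx orbT andbT.
  by rewrite ler_powR ?ler1n// ler_wpM2l//; lra.
rewrite mulrA ler_wpM2r//.
(* From 2^(t-1) < u follows 2^(t+1) < 4u, so neither minimum has reached its cap; hence the factor
   2^(2(P-1)) in [m]. *)
have h : 2 `^ ((P - 1) * (t + 1)) <= 2 `^ (2 * (P - 1)) * u `^ (P - 1).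
  rewrite (_ : (P - 1) * (t + 1) = 2 * (P - 1) + (t - 1) * (P - 1)); last by ring.
  rewrite [leLHS]powRD ?pnatr_eq0 ?implybT// ler_pM2l ?powR_gt0// powRrM.
  by apply: ge0_ler_powR; rewrite ?nnegrE ?powR_ge0//; lra.
have h' : 2 `^ ((P - 1) * t) <= 2 `^ (2 * (P - 1)) * u `^ (P - 1).
  by apply: le_trans h; rewrite ler_powR ?ler1n// ler_wpM2l//; lra.
rewrite /m !min_l// mulrDr mulr1 (@powRD _ _ (_ * t)) ?pnatr_eq0 ?implybT//; lra.
Qed.

(** Pairing [i] with [-(i+1)] enumerates the integer scales: [n] pairs run over the exponents from
    [-n] to [n-1], and [dyadic_term] telescopes them to [m(n) - m(-n)], which is at most the cap. *)
Lemma dyadic_sum P u (n : nat) : 1 < P -> 0 <= u ->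
  \sum_(0 <= i < n) (2 `^ ((P - 1) * i%:R) * tail (2 `^ (i%:R - 1)) u +
    2 `^ ((P - 1) * - i.+1%:R) * tail (2 `^ (- i.+1%:R - 1)) u) <=
  2 `^ (2 * (P - 1)) / (2 `^ (P - 1) - 1) * u `^ P.
Proof.
move=> P1 u0.
have th : 0 < 2 `^ (P - 1) - 1 :> R.
  by rewrite subr_gt0 -[ltLHS](powRr0 2) ltr_powR2 subr_gt0.
rewrite mulrAC ler_pdivlMr// mulrC.
apply: (@le_trans _ _ ((m P u n%:R - m P u (- n%:R)) * u)); last first.
  rewrite -(mulr_powRB1 u0); last by lra.
  rewrite mulrCA [leRHS]mulrC ler_wpM2r//.
  have m0 : 0 <= m P u (- n%:R) by rewrite le_min ?mulr_ge0 ?powR_ge0.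
  rewrite lerBlDr (le_trans (_ : _ <= 2 `^ (2 * (P - 1)) * u `^ (P - 1)))//.
    by rewrite /m ge_min lexx orbT.
  by rewrite lerDl.
elim: n => [|n ih]; first by rewrite big_nil mulr0 oppr0 subrr mul0r.
rewrite big_nat_recr//= mulrDr.
have := dyadic_term n%:R P1 u0; have := dyadic_term (- n.+1%:R) P1 u0.
rewrite (_ : - n.+1%:R + 1 = - n%:R); last by rewrite -natr1; ring.
rewrite natr1 => h1 h2; lra.
Qed.

End DyadicSum.

Section StrongType.
Context {R : realType} {disp : measure_display} {X : measurableType disp}.
Variables (d : X -> X -> R) (mu : {measure set X -> \bar R}).
Hypothesis hX : homogeneous_type d mu.

Lemma measurable_tail (H : X -> R) (c : R) :
  measurable_fun setT H -> measurable_fun setT (fun x => tail c (H x)).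
Proof.
by move=> mH; apply: measurable_fun_ifT => //; exact: measurable_fun_ltr.
Qed.

(** The values of [H] up to [l / 2] contribute at most half of [l * mu B], so on a ball of average
    above [l] the remaining tail has average above [l / 2]. *)
Lemma weak_type_tail : exists2 K : R, (1 <= K)%R &
  forall H : X -> R, measurable_fun setT H -> (forall x, 0 <= H x)%R ->
  forall l : R, (0 < l)%R -> exists U, [/\ measurable U,
    forall B, qballs d B -> l%:E * mu B < \int[mu]_(x in B) (H x)%:E -> B `<=` U &
    l%:E * mu U <= K%:E * \int[mu]_x (tail (l / 2) (H x))%:E].
Proof.
have [K K1 weak] := weak_type hX; exists (2 * K)%R; first lra.
move=> H mH H0 l l0; have l20 : (0 < l / 2)%R by lra.
have mt : measurable_fun setT (fun x => (tail (l / 2) (H x))%:E).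
  exact/measurable_EFinP/measurable_tail.
have t0 x : 0 <= (tail (l / 2) (H x))%:E by rewrite lee_fin tail_ge0.
have [U [mU BU lU]] := weak _ mt t0 _ l20.
exists U; split=> //; last first.
  have -> : l%:E = 2%:E * (l / 2)%:E by rewrite -EFinM mulrCA divff// mulr1.
  by rewrite (EFinM 2 K) -!muleA lee_pmul2l.
move=> B dB lB; apply: BU => //.
have mB : measurable B by exact: (measurable_qballs hX).
have : \int[mu]_(x in B) (H x)%:E <=
    \int[mu]_(x in B) ((tail (l / 2) (H x))%:E + (cst (l / 2)%:E x)).
  apply: ge0_le_integral => //.
  - by move=> x _; rewrite lee_fin.
  - by apply: measurable_funTS; exact/measurable_EFinP.
  - by apply: emeasurable_funD => //; exact: measurable_funTS.
  - move=> x _; rewrite -EFinD lee_fin /tail; case: ltP => //=; lra.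
rewrite ge0_integralD//; [|exact: measurable_funTS|by move=> x _; rewrite lee_fin ltW].
rewrite integral_cst// => /(lt_le_trans lB).
rewrite (volE hX)// -!EFinM.
have -> : ((l * vol mu B)%:E = (l / 2 * vol mu B)%:E + (l / 2 * vol mu B)%:E).
  by rewrite -EFinD; congr (_%:E); field.
by rewrite lteD2rE.
Qed.

(** [W] is the sum over integers k of 2^((k+1)P) on the set [U] of level 2^k. If 2^k < a <= 2^(k+1),
    a ball of average at least [a] lies in that set, so [W] is at least [a^P] on it. The integral of
    [W] is summed by [weak_type_tail] and [dyadic_sum]. *)
Lemma strong_type (P : R) : (1 < P)%R -> exists2 K : R, (0 < K)%R &
  forall H : X -> R, measurable_fun setT H -> (forall x, 0 <= H x)%R ->
  exists W : X -> \bar R, [/\ measurable_fun setT W, forall x, 0 <= W x,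
    forall B x a, qballs d B -> B x -> (0 <= a)%R ->
      a%:E * mu B <= \int[mu]_(y in B) (H y)%:E -> (a `^ P)%:E <= W x &
    \int[mu]_x W x <= K%:E * \int[mu]_x (H x `^ P)%:E].
Proof.
move=> P1; have [K K1 weak] := weak_type_tail.
have K0 : (0 < K)%R by exact: lt_le_trans K1.
have P0 : (0 < P)%R by lra.
have th : (0 < 2 `^ (P - 1) - 1 :> R)%R.
  by rewrite subr_gt0 -[ltLHS](powRr0 2) ltr_powR2 subr_gt0.
pose Q : R := (2 `^ (2 * (P - 1)) / (2 `^ (P - 1) - 1))%R.
have Q0 : (0 < Q)%R by rewrite divr_gt0// powR_gt0.
(* The weak type bound turns 2^((t+1)P) into 2^((t+1)P - t), and (t+1)P - t = P + (P-1)t. *)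
pose L : R := (K * 2 `^ P)%R.
have L0 : (0 < L)%R by rewrite mulr_gt0// powR_gt0.
exists (L * Q)%R; first by rewrite mulr_gt0.
move=> H mH H0.
have /choice[U UP] : forall t : R, exists U, [/\ measurable U,
    forall B, qballs d B -> (2 `^ t)%:E * mu B < \int[mu]_(x in B) (H x)%:E ->
      B `<=` U &
    (2 `^ t)%:E * mu U <= K%:E * \int[mu]_x (tail (2 `^ (t - 1)) (H x))%:E].
  move=> t; have [|U [mU BU lU]] := weak _ mH H0 (2 `^ t)%R; first exact: powR_gt0.
  exists U; split=> //; suff -> : (2 `^ (t - 1) = 2 `^ t / 2 :> R)%R by [].
  by rewrite powRB ?pnatr_eq0 ?implybT// powRr1.
pose f t x := (2 `^ ((t + 1) * P) * \1_(U t) x)%R.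
pose g t x := (2 `^ ((P - 1) * t) * tail (2 `^ (t - 1)) (H x))%R.
have f0 t x : (0 <= f t x)%R by rewrite mulr_ge0// powR_ge0.
have g0 t x : (0 <= g t x)%R by rewrite mulr_ge0 ?powR_ge0 ?tail_ge0.
have mU t : measurable (U t) by have [] := UP t.
have mf t : measurable_fun setT (fun x => (f t x)%:E).
  apply/measurable_EFinP; apply: measurable_funM => //.
have mg t : measurable_fun setT (fun x => (g t x)%:E).
  apply/measurable_EFinP; apply: measurable_funM => //; exact: measurable_tail.
have intfg t : \int[mu]_x (f t x)%:E <= L%:E * \int[mu]_x (g t x)%:E.
  rewrite /f /g.
  under eq_integral do rewrite EFinM.
  under [X in _ <= _ * X]eq_integral do rewrite EFinM.
  have t0 x : 0 <= (tail (2 `^ (t - 1)) (H x))%:E by rewrite lee_fin tail_ge0.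
  have mt : measurable_fun setT (fun x => (tail (2 `^ (t - 1)) (H x))%:E).
    exact/measurable_EFinP/measurable_tail.
  have i0 x : 0 <= (\1_(U t) x : R)%:E by rewrite lee_fin.
  have mi : measurable_fun setT (fun x => (\1_(U t) x : R)%:E).
    exact/measurable_EFinP.
  rewrite !ge0_integralZl_EFin ?powR_ge0//.
  rewrite integral_indic// setIT.
  have [_ _] := UP t.
  have h : (0 < 2 `^ ((t + 1) * P - t) :> R)%R by exact: powR_gt0.
  rewrite -(@lee_pmul2l _ (2 `^ ((t + 1) * P - t))%:E)// !muleA -!EFinM.
  rewrite -powRD ?pnatr_eq0 ?implybT// subrK => /le_trans; apply.
  rewrite lee_wpmul2r//; first by apply: integral_ge0 => x _; rewrite lee_fin tail_ge0.
  rewrite /L lee_fin mulrC -mulrA ler_pM2l// -powRD ?pnatr_eq0 ?implybT//.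
  by rewrite le_eqVlt; apply/orP; left; apply/eqP; congr (2 `^ _)%R; ring.
pose F n x : \bar R := (f n%:R x)%:E + (f (- n.+1%:R) x)%:E.
pose G n x : \bar R := (g n%:R x)%:E + (g (- n.+1%:R) x)%:E.
have F0 n x : 0 <= F n x by rewrite adde_ge0 ?lee_fin.
have G0 n x : 0 <= G n x by rewrite adde_ge0 ?lee_fin.
have mF n : measurable_fun setT (F n) by exact: emeasurable_funD.
have mG n : measurable_fun setT (G n) by exact: emeasurable_funD.
have intFG n : \int[mu]_x F n x <= L%:E * \int[mu]_x G n x.
  rewrite /F /G !ge0_integralD//; try by move=> x _; rewrite lee_fin.
  rewrite muleDr//; last first.
    by apply: ge0_adde_def; rewrite inE; apply: integral_ge0 => x _; rewrite lee_fin.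
  exact: leeD.
exists (fun x => \sum_(n <oo) F n x); split.
- by apply: ge0_emeasurable_sum.
- by move=> x; exact: nneseries_ge0.
- move=> B x a dB Bx a0 aB.
  have [a00|aN0] := eqVneq a 0%R.
    by rewrite a00 powR0 ?gt_eqF//; exact: nneseries_ge0.
  have {}a0 : (0 < a)%R by rewrite lt_def aN0.
  have [k /andP[ka ak]] := dyadic_bracket a0.
  have Uk : U k%:~R x.
    have [_ + _] := UP k%:~R; move=> /(_ B dB); apply => //.
    apply: lt_le_trans aB.
    by rewrite (volE hX)// -!EFinM lte_fin ltr_pM2r// (vol_gt0 hX).
  have ak' : (a `^ P <= f k%:~R x)%R.
    rewrite /f indicE mem_set// mulr1 powRrM.
    by apply: ge0_ler_powR; rewrite ?nnegrE ?powR_ge0// ltW.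
  have [n aF] : exists n, (a `^ P)%:E <= F n x.
    have F_ge n : (f n%:R x <= f n%:R x + f (- n.+1%:R) x)%R /\
        (f (- n.+1%:R) x <= f n%:R x + f (- n.+1%:R) x)%R.
      by rewrite lerDl lerDr.
    case: k ak' {ka ak Uk} => n ak'; exists n; rewrite lee_fin (le_trans ak')//.
      exact: (F_ge n).1.
    exact: (F_ge n).2.
  apply: (le_trans aF); rewrite (nneseriesD1 (n := n))//.
  by rewrite leeDl//; exact: nneseries_ge0.
rewrite integral_nneseries//.
apply: (@le_trans _ _ (L%:E * \int[mu]_x \sum_(n <oo) G n x)).
  rewrite integral_nneseries// -nneseriesZl; last first.
    by move=> n _; exact: integral_ge0.
  by apply: lee_nneseries => // n _ _; exact: integral_ge0.
rewrite [(L * Q)%:E]EFinM -muleA lee_pmul2l//.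
have mHP : measurable_fun setT (fun x => (H x `^ P)%:E).
  by apply/measurable_EFinP; exact: (measurableT_comp (measurable_powR P)).
rewrite -(@ge0_integralZl_EFin _ _ _ mu _ measurableT _ _ mHP Q (ltW Q0)); last first.
  by move=> x _; rewrite lee_fin powR_ge0.
apply: ge0_le_integral => //.
- by move=> x _; exact: nneseries_ge0.
- exact: ge0_emeasurable_sum.
- by apply: emeasurable_funM.
- move=> x _; apply: lime_le; first exact: is_cvg_nneseries.
  apply: nearW => n; under eq_bigr do rewrite /G -EFinD.
  by rewrite sumEFin -EFinM lee_fin; exact: dyadic_sum.
Qed.

End StrongType.

(** * The exponent on a ball *)

Section LogHolder.
Context {R : realType} {disp : measure_display} {X : measurableType disp}.
Variables (d : X -> X -> R) (mu : {measure set X -> \bar R}).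
Hypothesis hX : homogeneous_type d mu.
Variable x0 : X.
Local Open Scope ring_scope.

Lemma ln_expR1D_ge1 x : 1 <= ln (expR 1 + d x x0).
Proof.
rewrite -[leLHS]expRK ler_ln ?posrE ?expR_gt0 ?ltr_wpDr ?(qd_ge0 hX) ?expR_gt0//.
by rewrite lerDl (qd_ge0 hX).
Qed.

(** Logarithmic form of the polynomial lower volume bound, with [Q] the base-2 logarithm of the
    doubling constant: the unit ball about [x0] lies in the ball about [z] of radius
    [A * (1 + d z x0)], which is reached from [rho] by [n] doublings. *)
Lemma neg_ln_vol_le : exists K Q : R, [/\ 0 <= K, 0 <= Q & forall z rho, 0 < rho ->
  - ln (vol mu (qball d z rho)) <= K + Q * ln (1 + (1 + d z x0) / rho)].
Proof.
have [A A1 tri] := qd_triangle hX.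
have A0 : 0 < A by exact: lt_le_trans A1.
have [C C1 dbl] := doubling_iter hX.
have C0 : 0 < C by exact: lt_le_trans C1.
have lnC : 0 <= ln C by exact: ln_ge0.
have lnA : 0 <= ln A by exact: ln_ge0.
have ln2 := @ln2_gt0 R.
pose Q := ln C / ln 2.
have Q0 : 0 <= Q by rewrite divr_ge0// ltW.
pose c0 := vol mu (qball d x0 1).
have c00 : 0 < c0 by apply: (vol_gt0 hX); exact: qballs_qball.
exists (`|ln c0| + ln C + Q * ln A), Q; split => //.
  by rewrite !addr_ge0// mulr_ge0.
move=> z rho rho0.
pose S := A * (1 + d z x0).
have S0 : 0 < S by rewrite mulr_gt0// ltr_wpDr// (qd_ge0 hX).
pose n := ex_minn (exists_pow2 (S / rho)).
have [nS nmin] : S / rho <= 2 ^+ n /\ forall m, S / rho <= 2 ^+ m -> (n <= m)%N.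
  by rewrite /n; case: ex_minnP.
have c0B : c0 <= C ^+ n * vol mu (qball d z rho).
  apply: le_trans (dbl n z rho rho0); apply: (le_vol hX).
  - exact: qballs_qball.
  - by apply: qballs_qball; rewrite mulr_gt0// exprn_gt0.
  move=> y; rewrite /qball/= => y1.
  apply: (le_lt_trans (tri _ _ x0)).
  apply: (@lt_le_trans _ _ S); last by rewrite -ler_pdivrMr.
  by rewrite ltr_pM2l// addrC ltrD2r (qd_sym hX).
have vB : 0 < vol mu (qball d z rho).
  by apply: (vol_gt0 hX); exact: qballs_qball.
have h1 : ln c0 <= n%:R * ln C + ln (vol mu (qball d z rho)).
  rewrite mulr_natl -lnXn// -lnM ?posrE ?exprn_gt0// ler_ln ?posrE//.
  by rewrite mulr_gt0// exprn_gt0.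
pose t := (1 + d z x0) / rho.
have t0 : 0 < t by rewrite divr_gt0// ltr_wpDr// (qd_ge0 hX).
have lnt : 0 <= ln (1 + t) by rewrite ln_ge0// lerDl ltW.
have SE : S / rho = A * t by rewrite /S /t mulrA.
have h2 : n%:R * ln 2 <= ln 2 + (ln A + ln (1 + t)).
  case: n nmin {nS h1 c0B} => [|m] nmin; first by rewrite mul0r !addr_ge0// ltW.
  have mS : 2 ^+ m < S / rho by rewrite ltNge; apply/negP => /nmin; rewrite ltnn.
  rewrite -natr1 mulrDl mul1r addrC lerD2l mulr_natl -lnXn//.
  rewrite -lnM ?posrE ?ltr_wpDl// ?ler_ln ?posrE ?exprn_gt0//; last first.
    by rewrite mulr_gt0// ltr_wpDl.
  rewrite (le_trans (ltW mS))// SE ler_pM2l//; lra.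
have h3 : n%:R * ln C <= ln C + Q * (ln A + ln (1 + t)).
  have := ler_wpM2l Q0 h2.
  have QE : Q * ln 2 = ln C by rewrite /Q divfK// gt_eqF.
  by rewrite [in leRHS]mulrDr QE mulrCA QE.
have := ler_norm (- ln c0); rewrite normrN -/t.
rewrite mulrDr in h3; lra.
Qed.

(** Exponentiated, this bounds mu(B)^-|r(x)-r(y)|. The lower volume bound splits [- ln (vol mu B)]
    into a part growing with the distance to [x0], paid for by [LH_infty], and a part [- ln rho],
    paid for by [LH0]. *)
Lemma log_oscillation (r : X -> R) : LH d x0 r -> exists2 C, 0 <= C &
  forall B x y, qballs d B -> B x -> B y ->
    `|r x - r y| * - ln (vol mu B) <= C.
Proof.
move=> [[C0 lh0] [Ci [ri lhi]]].
have [A A1 tri] := qd_triangle hX.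
have A0 : 0 < A by exact: lt_le_trans A1.
have [K [Q [K0 Q0 lnvol]]] := neg_ln_vol_le.
pose ell x := ln (expR 1 + d x x0).
have ell1 x : 1 <= ell x by exact: ln_expR1D_ge1.
have osc_ell x : `|r x - ri| * ell x <= `|Ci|.
  rewrite -ler_pdivlMr; last exact: lt_le_trans (ell1 x).
  apply: le_trans (lhi x) _; rewrite ler_pM2r ?ler_norm// invr_gt0.
  exact: lt_le_trans (ell1 x).
have osc_ri x : `|r x - ri| <= `|Ci|.
  by apply: le_trans (osc_ell x); rewrite ler_peMr.
have osc2 x y : `|r x - r y| <= `|r x - ri| + `|r y - ri|.
  by rewrite -[r x - r y](subrKA ri) (le_trans (ler_normD _ _))// [`|ri - _|]distrC.
pose M := 2 * `|Ci|.
have M0 : 0 <= M by rewrite mulr_ge0.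
have oscM x y : `|r x - r y| <= M.
  by have := osc2 x y; have := osc_ri x; have := osc_ri y; rewrite /M; lra.
have ln2 := @ln2_gt0 R.
have A20 : 0 < 2 * A by lra.
have AA0 : 0 < 4 * A ^+ 2 by rewrite mulr_gt0// exprn_gt0.
have A2 : 1 <= A ^+ 2 by rewrite exprn_ege1.
have lnA2 : 0 <= ln (2 * A) by rewrite ln_ge0//; lra.
have ln1A : 0 <= ln (1 + 2 * A) by rewrite ln_ge0//; lra.
have lnAA : 0 <= ln (4 * A ^+ 2) by rewrite ln_ge0//; lra.
pose T1 := M * ln (1 + 2 * A).
pose T2 := 2 * `|Ci| * (ln (2 * A) + 1).
pose T3 := M * ln (4 * A ^+ 2) + 2 * `|C0|.
have T10 : 0 <= T1 by rewrite mulr_ge0.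
have T20 : 0 <= T2 by rewrite mulr_ge0// addr_ge0.
have T30 : 0 <= T3 by rewrite addr_ge0// mulr_ge0.
have Ml2 : 0 <= M * ln 2 by rewrite mulr_ge0// ltW.
have QT : 0 <= Q * (T1 + M * ln 2 + T2 + T3).
  by rewrite mulr_ge0//; lra.
exists (M * K + Q * (T1 + M * ln 2 + T2 + T3)).
  by have := mulr_ge0 M0 K0; lra.
move=> _ x y [z [rho [rho0 ->]]] zx zy; rewrite /qball/= in zx zy.
pose o := `|r x - r y|; have o0 : 0 <= o by exact: normr_ge0.
apply: (@le_trans _ _ (o * (K + Q * ln (1 + (1 + d z x0) / rho)))).
  by apply: ler_wpM2l => //; exact: lnvol.
rewrite mulrDr (mulrCA o).
apply: lerD; first exact: ler_wpM2r (oscM x y).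
apply: ler_wpM2l => //.
have dz0 : 0 <= d z x0 by exact: (qd_ge0 hX).
pose E := expR 1 + d z x0.
have e1 : 1 < expR 1 :> R by rewrite expR_gt1.
have E1 : 1 + d z x0 <= E by rewrite /E; lra.
have E0 : 0 < E by rewrite /E; lra.
(* For a radius at least comparable to [E] the logarithm is bounded, and so is [r]. Otherwise every
   point [w] of the ball satisfies [E <= 2 * A * (expR 1 + d w x0)], and the decay of [r] at [w]
   compensates [ln E]. *)
have [rhoE|rhoE] := leP E (2 * A * rho).
  apply: (@le_trans _ _ T1); last by lra.
  rewrite ler_pM// ?oscM//.
    by rewrite ln_ge0// lerDl divr_ge0// ?ltW//; lra.
  rewrite ler_ln ?posrE; [|by rewrite ltr_wpDr// divr_ge0// ?ltW//; lra|lra].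
  by rewrite lerD2l ler_pdivrMr// (le_trans E1).
have lnE w : d z w < rho -> ln E <= (ln (2 * A) + 1) * ell w.
  move=> zw; have dw0 : 0 <= d w x0 by exact: (qd_ge0 hX).
  have h1 := tri z x0 w; rewrite (qd_sym hX x0 w) in h1.
  have h2 : A * d z w <= A * rho by rewrite ler_pM2l// ltW.
  have h3 : expR 1 <= A * expR 1 by rewrite ler_peMl//; lra.
  have h4 : E <= 2 * A * (expR 1 + d w x0).
    by rewrite mulrDr in h1; rewrite /E in rhoE *; lra.
  apply: (@le_trans _ _ (ln (2 * A) + ell w)).
    rewrite -lnM ?posrE//; last by lra.
    by rewrite ler_ln ?posrE// mulr_gt0//; lra.
  by rewrite [leRHS]mulrDl [X in _ <= _ + X]mul1r; apply: lerD => //; rewrite ler_peMr.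
have oE : o * ln E <= T2.
  apply: (@le_trans _ _ ((`|r x - ri| + `|r y - ri|) * ln E)).
    by rewrite ler_wpM2r ?osc2// ln_ge0//; lra.
  have half w : d z w < rho -> `|r w - ri| * ln E <= `|Ci| * (ln (2 * A) + 1).
    move=> zw; apply: le_trans (ler_wpM2l (normr_ge0 _) (lnE _ zw)) _.
    by rewrite mulrCA mulrC ler_wpM2r// addr_ge0.
  have := half _ zx; have := half _ zy; rewrite /T2 mulrDl; lra.
have orho : o * - ln rho <= T3.
  (* Below this threshold, [d x y < 2 * A * rho] is less than 1/2, so [LH0] applies, and its square
     is at most [rho], so [- ln rho] is at most twice [- ln (d x y)]. *)
  have [big|small] := leP 1 (4 * A ^+ 2 * rho).
    apply: (@le_trans _ _ (M * ln (4 * A ^+ 2))); last by rewrite lerDl mulr_ge0.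
    apply: (@le_trans _ _ (o * ln (4 * A ^+ 2))); last by rewrite ler_wpM2r// oscM.
    rewrite ler_wpM2l// -lnV ?posrE// ler_ln ?posrE ?invr_gt0//.
    by rewrite -div1r ler_pdivrMr.
  apply: (@le_trans _ _ (2 * `|C0|)); last by rewrite lerDr mulr_ge0.
  have [xy|/eqP xy] := eqVneq x y.
    by rewrite /o xy subrr normr0 mul0r mulr_ge0.
  have dxy0 : 0 < d x y.
    rewrite lt_def (qd_ge0 hX) andbT; apply/eqP => dxy; apply: xy.
    by have [_ h _ _] := homogeneous_quasi_metric hX; apply/h.
  have dxy : d x y < 2 * A * rho.
    apply: le_lt_trans (tri x y z) _.
    rewrite (qd_sym hX x z) (qd_sym hX y z) -mulrA mulrCA ltr_pM2l//; lra.
  have Arho : 2 * A * rho < 1 / 2.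
    have : 2 * A * rho * 1 <= 2 * A * rho * A by rewrite ler_pM2l// mulr_gt0.
    by rewrite expr2 in small; lra.
  have d2 : d x y < 1 / 2 by exact: lt_trans Arho.
  have lnd : ln (d x y) < 0 by apply: ln_lt0; rewrite dxy0/=; lra.
  have := lh0 _ _ xy d2; rewrite -/o mulNr -mulrN -invrN.
  rewrite ler_pdivlMr ?oppr_gt0// => oC.
  have sq : d x y ^+ 2 <= rho.
    apply: (@le_trans _ _ ((2 * A * rho) ^+ 2)).
      by rewrite ler_sqr ?nnegrE ?ltW// mulr_gt0.
    have -> : (2 * A * rho) ^+ 2 = (4 * A ^+ 2 * rho) * rho by ring.
    by rewrite -[leRHS]mul1r ler_pM2r// ltW.
  have lnrho : - ln rho <= 2 * - ln (d x y).
    rewrite mulrN lerN2 mulr_natl -lnXn// ler_ln ?posrE// exprn_gt0//.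
  have := ler_wpM2l o0 lnrho; have := ler_norm C0; lra.
apply: (@le_trans _ _ (o * (ln 2 + ln E - ln rho))).
  rewrite ler_wpM2l// -lnM ?posrE// -ln_div ?posrE ?mulr_gt0//.
  rewrite ler_ln ?posrE ?divr_gt0 ?mulr_gt0//; last first.
    by rewrite ltr_wpDr// divr_ge0// ?ltW//; lra.
  have h1 : 1 <= E / rho.
    rewrite ler_pdivlMr// mul1r (le_trans _ (ltW rhoE))// ler_peMl ?ltW//; lra.
  have h2 : (1 + d z x0) / rho <= E / rho by rewrite ler_pM2r// invr_gt0.
  by rewrite -mulrA; lra.
have ol2 : o * ln 2 <= M * ln 2 by rewrite ler_wpM2r ?oscM// ltW.
rewrite 2!mulrDr; lra.
Qed.

End LogHolder.

(** * Inequalities for real powers *)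

Section PowerEstimates.
Context {R : realType}.
Local Open Scope ring_scope.
Implicit Types (P a b m t h H K u v w eta : R).

Lemma powR_expR a u : 0 < a -> a `^ u = expR (u * ln a).
Proof. by move=> a0; rewrite /powR gt_eqF. Qed.

(** (t/a)^u is at most the larger of 1 and t/a. The bound is affine in [t], so it can be integrated
    over a ball. *)
Lemma powR_le_interp a t u : 0 < a -> 0 <= t -> 0 <= u <= 1 ->
  t `^ u <= a `^ u * (1 + t / a).
Proof.
move=> a0 t0 /andP[u0 u1].
have ta0 : 0 <= t / a by rewrite divr_ge0// ltW.
rewrite [in leLHS](_ : t = a * (t / a)); last by rewrite mulrC divfK ?gt_eqF.
rewrite powRM ?(ltW a0)// ler_pM2l ?powR_gt0//.
have [ta1|ta1] := leP (t / a) 1.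
  apply: (@le_trans _ _ (1 `^ u)); first by apply: ge0_ler_powR; rewrite ?nnegrE.
  by rewrite powR1 lerDl.
by rewrite (le_trans (ler1_powR (ltW ta1) u1))// lerDr.
Qed.

Lemma powR_young P a t : 1 < P -> 0 < a -> 0 <= t ->
  t <= a + a `^ (1 - P) * t `^ P.
Proof.
move=> P1 a0 t0; have [ta|ta] := leP t a.
  by rewrite (le_trans ta)// lerDl mulr_ge0 ?powR_ge0.
have {}t0 : 0 < t by exact: lt_trans ta.
rewrite (le_trans (_ : _ <= a `^ (1 - P) * t `^ P))// ?lerDr ?(ltW a0)//.
rewrite -(mulr_powRB1 (ltW t0)); last by lra.
rewrite mulrCA ler_peMr ?(ltW t0)//.
rewrite -opprB powRN ler_pdivlMl ?powR_gt0// mulr1.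
by apply: ge0_ler_powR; rewrite ?nnegrE ?(ltW a0) ?(ltW t0) ?(ltW ta)//; lra.
Qed.

Lemma powRD_le P u v : 0 < P -> 0 <= u -> 0 <= v ->
  (u + v) `^ P <= 2 `^ P * (u `^ P + v `^ P).
Proof.
move=> P0.
wlog uv : u v / u <= v.
  move=> wl u0 v0; have [uv|/ltW vu] := leP u v; first exact: wl.
  by rewrite addrC [_ + _ `^ P]addrC; exact: wl.
move=> u0 v0; apply: (@le_trans _ _ ((2 * v) `^ P)).
  apply: ge0_ler_powR; [exact: ltW|by rewrite nnegrE addr_ge0
    |by rewrite nnegrE mulr_ge0|lra].
by rewrite powRM// ler_wpM2l ?powR_ge0// lerDr powR_ge0.
Qed.

Section Exponents.
Variables (P eta K2 a m : R).
Hypotheses (P1 : 1 < P) (eta01 : 0 <= eta < 1) (K21 : 1 <= K2).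
Hypotheses (a0 : 0 < a) (m0 : 0 < m) (am : a `^ P * m <= K2).

Let P0 : 0 < P. Proof. exact: lt_trans P1. Qed.

Lemma powR_vol_le u : m `^ eta * a `^ (P * u) <= K2 * a `^ (P * (u - eta)).
Proof.
have P_gt1 := P1; have K2_ge1 := K21; have a_gt0 := a0.
have /andP[eta0 eta1] := eta01.
have am0 : 0 < a `^ P * m by rewrite mulr_gt0// powR_gt0.
rewrite mulrBr powRB ?(gt_eqF a0) ?implybT// mulrA ler_pdivlMr ?powR_gt0//.
rewrite mulrAC ler_pM2r ?powR_gt0// powRrM -powRM ?powR_ge0 ?(ltW m0)// mulrC.
apply: (@le_trans _ _ (K2 `^ eta)).
  by apply: ge0_ler_powR; rewrite ?nnegrE ?(ltW am0)//; lra.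
by apply: ler1_powR => //; exact: ltW.
Qed.

(** Since 1 <= a^P <= K2/m, exchanging [v] for [u] costs at most (K2/m)^|v-u|, hence [K2 * expR c]
    because |v-u| <= 1. In use, u = r(x), v = r(y) and h = F(y)^(1/P). *)
Lemma large_average (u v h c : R) : 1 <= a -> 0 <= h ->
  0 <= u <= P^-1 -> 0 <= v <= P^-1 -> `|v - u| * - ln m <= c ->
  h `^ (P * v) <= K2 * expR c * a `^ (P * u) * (1 + h / a).
Proof.
have P_gt1 := P1; have K2_ge1 := K21; have a_gt0 := a0.
move=> a1 h0 /andP[u0 u1] /andP[v0 v1] osc.
have iP : P^-1 <= 1 by rewrite invf_le1// ltW.
have vP : 0 <= P * v <= 1.
  by rewrite mulr_ge0 ?(ltW P0)//= mulrC -ler_pdivlMr// div1r.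
apply: (le_trans (powR_le_interp a0 h0 vP)).
rewrite ler_wpM2r ?addr_ge0 ?divr_ge0 ?(ltW a0)//.
have -> : P * v = P * (v - u) + P * u by ring.
rewrite powRD ?(gt_eqF a0) ?implybT// ler_pM2r ?powR_gt0//.
rewrite powR_expR// -[X in _ <= X * _]lnK ?posrE; last by lra.
rewrite -expRD ler_expR.
have lna : 0 <= ln a by rewrite ln_ge0.
have lnam : P * ln a <= ln K2 - ln m.
  rewrite lerBrDr -ln_powR -lnM ?posrE ?powR_gt0// ler_ln ?posrE//; last lra.
  by rewrite mulr_gt0// powR_gt0.
have lnK2 : 0 <= ln K2 by rewrite ln_ge0.
have n1 : `|v - u| <= 1 by rewrite ler_norml; lra.
apply: (@le_trans _ _ (`|v - u| * (P * ln a))).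
  by rewrite mulrAC mulrC ler_wpM2r ?mulr_ge0 ?ler_norm ?(ltW P0).
apply: (le_trans (ler_wpM2l (normr_ge0 _) lnam)).
have := ler_wpM2r lnK2 n1; rewrite mulrBr mul1r; rewrite mulrN in osc; lra.
Qed.

Lemma small_average (u v h e c : R) : a < 1 -> 0 <= h -> 0 < e -> e <= 1 ->
  0 <= u <= P^-1 -> 0 <= v <= P^-1 -> `|v - u| * (P * - ln e) <= c ->
  h `^ (P * v) <= expR c * a `^ (P * u) * (1 + (h + e) / a).
Proof.
have P_gt1 := P1; have a_gt0 := a0.
move=> a1 h0 e0 e1 /andP[u0 u1] /andP[v0 v1] osc.
have c0 : 0 <= c.
  by apply: le_trans osc; rewrite mulr_ge0// mulr_ge0 ?(ltW P0)// oppr_ge0 ln_le0.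
have vP : 0 <= P * v <= 1.
  by rewrite mulr_ge0 ?(ltW P0)//= mulrC -ler_pdivlMr// div1r.
have uP : 0 <= P * u <= 1.
  by rewrite mulr_ge0 ?(ltW P0)//= mulrC -ler_pdivlMr// div1r.
have /andP[vP0 vP1] := vP; have /andP[uP0 uP1] := uP.
pose H := h + e; have H0 : 0 < H by rewrite /H; lra.
have Ha0 : 0 < H / a by rewrite divr_gt0.
apply: (@le_trans _ _ (H `^ (P * v))).
  by apply: ge0_ler_powR; rewrite ?nnegrE ?(ltW H0)// /H; lra.
rewrite -/H -mulrA; have [H1|H1] := leP H 1; last first.
  apply: (le_trans (ler1_powR (ltW H1) vP1)).
  apply: (@le_trans _ _ (a `^ (P * u) * (1 + H / a))); last first.
    by rewrite ler_peMl ?mulr_ge0 ?powR_ge0// ?addr_ge0// ?(ltW Ha0)// -expR0 ler_expR.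
  apply: (@le_trans _ _ (a * (H / a))); first by rewrite mulrC divfK ?gt_eqF.
  apply: ler_pM; rewrite ?(ltW a0) ?(ltW Ha0)//; last by rewrite lerDr.
  by apply: ger1_powR => //; rewrite a0 ltW.
have -> : P * v = P * (v - u) + P * u by ring.
rewrite powRD ?(gt_eqF H0) ?implybT//.
apply: ler_pM; rewrite ?powR_ge0//; last exact: powR_le_interp (ltW H0) uP.
rewrite powR_expR// ler_expR; apply: le_trans osc.
apply: (@le_trans _ _ (`|v - u| * (P * - ln H))).
  have hP : 0 <= P * - ln H by rewrite mulr_ge0 ?(ltW P0)// oppr_ge0 ln_le0.
  rewrite (_ : P * (v - u) * ln H = - (v - u) * (P * - ln H)); last by ring.
  by rewrite ler_wpM2r// -normrN ler_norm.
rewrite ler_wpM2l// ler_pM2l// lerN2 ler_ln ?posrE// /H; lra.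
Qed.

(** The base a + e lies between [e] and 2, so |ln (a + e)| <= ln 2 - ln e, and exchanging exponents
    costs at most 2^P times [expR c]. In use, u = r_oo and v = r(x). *)
Lemma recenter_exponent (u v e c : R) : a < 1 -> 0 < e -> e <= 1 ->
  eta <= u <= P^-1 -> eta <= v <= P^-1 -> `|v - u| * (P * - ln e) <= c ->
  a `^ (P * (u - eta)) <= 2 `^ P * expR c * (a + e) `^ (P * (v - eta)).
Proof.
have P_gt1 := P1; have a_gt0 := a0.
move=> a1 e0 e1 /andP[u0 u1] /andP[v0 v1] osc.
have /andP[eta0 eta1] := eta01.
have iP : P^-1 <= 1 by rewrite invf_le1// ltW.
pose b := a + e; have b0 : 0 < b by rewrite /b; lra.
apply: (@le_trans _ _ (b `^ (P * (u - eta)))).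
  apply: ge0_ler_powR; rewrite ?nnegrE ?(ltW a0) ?(ltW b0)//; last by rewrite /b; lra.
  by rewrite mulr_ge0 ?(ltW P0)//; lra.
rewrite -/b (_ : P * (u - eta) = P * (u - v) + P * (v - eta)); last by ring.
rewrite powRD ?(gt_eqF b0) ?implybT// ler_pM2r ?powR_gt0//.
rewrite !powR_expR// -expRD ler_expR.
have lne : 0 <= - ln e by rewrite oppr_ge0 ln_le0.
have ln2 := @ln2_gt0 R.
have n1 : `|v - u| <= 1 by rewrite ler_norml; lra.
have lnb : `|ln b| <= ln 2 - ln e.
  rewrite ler_norml; apply/andP; split.
    have : ln e <= ln b by rewrite ler_ln ?posrE// /b; lra.
    lra.
  have : ln b <= ln 2 by rewrite ler_ln ?posrE// /b; lra.
  lra.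
apply: (@le_trans _ _ (`|v - u| * (P * `|ln b|))).
  rewrite (le_trans (ler_norm _))// !normrM (ger0_norm (ltW P0)) distrC.
  by rewrite [leRHS]mulrCA mulrA.
apply: (@le_trans _ _ (`|v - u| * (P * (ln 2 - ln e)))).
  by rewrite ler_wpM2l// ler_pM2l.
have := ler_wpM2r (mulr_ge0 (ltW P0) (ltW ln2)) n1.
by rewrite mul1r mulrDr mulrDr; lra.
Qed.

End Exponents.
End PowerEstimates.

(** * The key estimate *)

Section KeyEstimate.
Context {R : realType} {disp : measure_display} {X : measurableType disp}.
Variables (d : X -> X -> R) (mu : {measure set X -> \bar R}).
Hypothesis hX : homogeneous_type d mu.
Variable x0 : X.

Definition weight (N : nat) (x : X) : R := ((expR 1 + d x x0)^-1 ^+ N)%R.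

Let e_gt1 : (1 < expR 1 :> R)%R. Proof. by rewrite expR_gt1. Qed.

Let ed_gt1 x : (1 < expR 1 + d x x0)%R.
Proof. by rewrite (lt_le_trans e_gt1)// lerDl (qd_ge0 hX). Qed.

Let ed_gt0 x : (0 < expR 1 + d x x0)%R.
Proof. exact: lt_trans (ed_gt1 x). Qed.

Lemma weight_gt0 N x : (0 < weight N x)%R.
Proof. by rewrite exprn_gt0// invr_gt0. Qed.

Lemma weight_le1 N x : (weight N x <= 1)%R.
Proof.
by rewrite exprn_ile1// ?invr_ge0 ?(ltW (ed_gt0 _))// invf_le1// ltW.
Qed.

Lemma ln_weight N x : ln (weight N x) = (- (N%:R * ln (expR 1 + d x x0)))%R.
Proof.
by rewrite /weight lnXn ?invr_gt0// lnV ?posrE// mulNrn mulr_natl.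
Qed.

Lemma measurable_weight N : measurable_fun setT (weight N).
Proof.
have -> : weight N = (fun x => (expR 1 + d x x0) `^ (- N%:R))%R.
  by apply/funext => x; rewrite powR_invn ?(ltW (ed_gt0 _))// /weight exprVn.
apply: (measurableT_comp (measurable_powR _)).
apply: measurable_funD => //.
have -> : (d^~ x0) = d x0 by apply/funext => x; rewrite (qd_sym hX).
exact: measurable_qd hX _.
Qed.

(** With 2C <= 2^N, the least [n] such that e + d(x,x0) <= 2^n gives a weight at most 2^N (2C)^-n.
    The balls of radius 2^n about [x0] have measure at most C^n c0, so a geometric series of ratio
    1/2 remains. *)
Lemma weight_integrable : exists N (K : R), \int[mu]_x (weight N x)%:E <= K%:E.
Proof.
have [C C1 dbl] := doubling_iter hX.
have C0 : (0 < C)%R by exact: lt_le_trans C1.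
have [N CN] := exists_pow2 (2 * C).
have C20 : (0 < 2 * C)%R by rewrite mulr_gt0.
pose c0 := vol mu (qball d x0 1).
have c00 : (0 < c0)%R by apply: (vol_gt0 hX); exact: qballs_qball.
pose b n : R := (2 ^+ N * (2 * C)^-1 ^+ n)%R.
have b0 n : (0 <= b n)%R by rewrite mulr_ge0 ?exprn_ge0// invr_ge0 ltW.
pose D n := qball d x0 (2 ^+ n * 1).
have mD n : measurable (D n) by exact: (measurable_qball hX).
exists N, (2 ^+ N * c0 * 2)%R.
have m1 n : measurable_fun setT (fun x => (\1_(D n) x : R)%:E).
  exact/measurable_EFinP.
have mb n : measurable_fun setT (fun x => (b n)%:E * (\1_(D n) x : R)%:E).
  exact: emeasurable_funM.
have bD0 n x : 0 <= (b n)%:E * (\1_(D n) x : R)%:E by rewrite -EFinM lee_fin mulr_ge0.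
apply: (@le_trans _ _ (\int[mu]_x \sum_(n <oo) (b n)%:E * (\1_(D n) x : R)%:E)).
  apply: ge0_le_integral => //.
  - by move=> x _; rewrite lee_fin ltW// weight_gt0.
  - exact/measurable_EFinP/measurable_weight.
  - exact: ge0_emeasurable_sum.
  move=> x _.
  pose n := ex_minn (exists_pow2 (expR 1 + d x x0)).
  have [nS nmin] : (expR 1 + d x x0 <= 2 ^+ n)%R /\
      forall m, (expR 1 + d x x0 <= 2 ^+ m)%R -> (n <= m)%N.
    by rewrite /n; case: ex_minnP.
  apply: (@le_trans _ _ ((b n)%:E * (\1_(D n) x : R)%:E)); last first.
    rewrite (nneseriesD1 (n := n))//.
    by rewrite leeDl//; exact: nneseries_ge0.
  have Dx : D n x.
    rewrite /D /qball/= mulr1 (qd_sym hX); apply: lt_le_trans nS.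
    by rewrite ltrDr expR_gt0.
  rewrite indicE mem_set// mule1 lee_fin /b.
  case: n nmin {nS Dx} => [|m] nmin.
    by rewrite expr0 mulr1 (le_trans (weight_le1 _ _))// exprn_ege1// ler1n.
  have mS : (2 ^+ m < expR 1 + d x x0)%R.
    by rewrite ltNge; apply/negP => /nmin; rewrite ltnn.
  apply: (@le_trans _ _ ((2 ^+ m)^-1 ^+ N)%R).
    rewrite /weight lerXn2r// ?nnegrE ?invr_ge0 ?exprn_ge0 ?(ltW (ed_gt0 _))//.
    by rewrite lef_pV2 ?posrE ?exprn_gt0// ltW.
  rewrite exprVn -exprM mulnC exprM -exprVn exprSr.
  have -> : ((2 ^+ N)^-1 ^+ m = 2 ^+ N * ((2 ^+ N)^-1 ^+ m * (2 ^+ N)^-1) :> R)%R.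
    by rewrite mulrCA divff ?mulr1// expf_neq0.
  rewrite ler_pM2l ?exprn_gt0//.
  by rewrite -!exprSr lerXn2r// ?nnegrE ?invr_ge0 ?exprn_ge0 ?(ltW C20)// lef_pV2 ?posrE ?exprn_gt0.
rewrite integral_nneseries//.
under eq_eseriesr do rewrite ge0_integralZl_EFin// integral_indic// setIT.
have bv n : (b n)%:E * mu (D n) <= (2 ^+ N * c0 * 2^-1 ^+ n)%:E.
  rewrite (volE hX); last by apply: qballs_qball; rewrite mulr_gt0// exprn_gt0.
  rewrite -EFinM lee_fin /b.
  apply: (@le_trans _ _ (2 ^+ N * (2 * C)^-1 ^+ n * (C ^+ n * c0)))%R.
    by apply: ler_wpM2l; [exact: b0|exact: dbl].
  rewrite invfM exprMn (exprVn C).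
  have Cn : (C ^+ n != 0)%R by rewrite expf_neq0// gt_eqF.
  rewrite le_eqVlt; apply/orP; left; apply/eqP; field.
  exact: Cn.
apply: lime_le.
  apply: is_cvg_nneseries => n _ _; by rewrite mule_ge0// lee_fin.
apply: nearW => n; apply: (@le_trans _ _ (\sum_(0 <= i < n) (2 ^+ N * c0 * 2^-1 ^+ i)%:E)).
  exact: lee_sum.
rewrite sumEFin lee_fin -mulr_sumr ler_pM2l ?mulr_gt0 ?exprn_gt0//.
suff : (\sum_(0 <= i < n) 2^-1 ^+ i = 2 - 2 * 2^-1 ^+ n :> R)%R.
  by move=> ->; rewrite lerBlDr lerDl mulr_ge0// exprn_ge0// invr_ge0.
elim: n => [|n ih]; first by rewrite big_nil expr0; ring.
by rewrite big_nat_recr//= ih exprS; field.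
Qed.

End KeyEstimate.

Lemma measurable_fun_powR2 {disp : measure_display} {X : measurableType disp}
    {R : realType} (f g : X -> R) :
  measurable_fun setT f -> measurable_fun setT g ->
  measurable_fun setT (fun x => f x `^ g x)%R.
Proof.
move=> mf mg; rewrite /powR; apply: measurable_fun_ifT.
- exact: measurable_fun_eqr.
(* At base 0 the power is 1 for exponent 0 and 0 otherwise. *)
- rewrite (_ : (fun x => _) = (fun x => if g x == 0%R then 1%R else 0%R : R)).
    by apply: measurable_fun_ifT => //; exact: measurable_fun_eqr.
  by apply/funext => x; case: ifP.
- apply: measurableT_comp => //; apply: measurable_funM => //.
  exact: measurableT_comp.
Qed.

(** * Averages over a ball *)

Section Averages.
Context {R : realType} {disp : measure_display} {X : measurableType disp}.
Variables (mu : {measure set X -> \bar R}) (B : set X) (H : X -> R) (m : R).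
Hypotheses (mB : measurable B) (muB : mu B = m%:E) (m0 : (0 < m)%R).
Hypotheses (mH : measurable_fun setT H) (H0 : forall x, (0 <= H x)%R).

Let mHB : measurable_fun B (fun x => (H x)%:E).
Proof. by apply: measurable_funTS; exact/measurable_EFinP. Qed.

Let HB0 x : B x -> 0 <= (H x)%:E. Proof. by rewrite lee_fin. Qed.

Lemma average_gt0 : (forall x, 0 < H x)%R -> 0 < \int[mu]_(x in B) (H x)%:E.
Proof.
move=> Hgt0; rewrite lt_def integral_ge0 ?andbT//; apply/eqP => I0.
have /(ae_eq_integral_abs mu mB mHB) : \int[mu]_(x in B) `|(H x)%:E| = 0.
  by rewrite -[RHS]I0; apply: eq_integral => x _; rewrite gee0_abs ?lee_fin.
move=> HB; have : mu.-negligible B.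
  apply: negligibleS HB => x Bx /= /(_ Bx) /eqP; apply/negP.
  by rewrite eqe gt_eqF.
move=> /(measure_negligible mB) muB0.
have [m00] : m%:E = 0 :> \bar R by rewrite -muB; exact: muB0.
by move: m0; rewrite m00 ltxx.
Qed.

Lemma average_le (P K : R) : (1 < P)%R -> (0 < K)%R ->
  \int[mu]_x (H x `^ P)%:E <= K%:E ->
  \int[mu]_(x in B) (H x)%:E <= (2 * (K / m) `^ P^-1 * m)%:E.
Proof.
move=> P1 K0 HK.
have P0 : (0 < P)%R by lra.
have Km : (0 < K / m)%R by rewrite divr_gt0.
(* This level balances the two terms of [powR_young]: l^(1-P) K = l m. *)
pose l := ((K / m) `^ P^-1)%R; have l0 : (0 < l)%R by rewrite powR_gt0.
have lP : (l `^ P = K / m)%R.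
  by rewrite -powRrM mulVf ?(gt_eqF P0)// powRr1// ltW.
have mHP D : measurable_fun D (fun x => (H x `^ P)%:E).
  apply: measurable_funTS; apply/measurable_EFinP.
  exact: (measurableT_comp (measurable_powR P)).
apply: (@le_trans _ _ (\int[mu]_(x in B) (l%:E + (l `^ (1 - P))%:E * (H x `^ P)%:E))).
  apply: ge0_le_integral => //.
    by apply: emeasurable_funD => //; exact: emeasurable_funM.
  by move=> x _; rewrite -EFinM -EFinD lee_fin; exact: powR_young.
rewrite ge0_integralD//; last 3 first.
- by move=> x _; rewrite lee_fin ltW.
- by move=> x _; rewrite -EFinM lee_fin mulr_ge0 ?powR_ge0.
- exact: emeasurable_funM.
rewrite ge0_integralZl_EFin ?powR_ge0//; last by move=> x _; rewrite lee_fin powR_ge0.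
rewrite (integral_cst mu mB l%:E). rewrite muB.
have HBK : \int[mu]_(x in B) (H x `^ P)%:E <= K%:E.
  apply: le_trans HK; apply: ge0_subset_integral => //.
  by move=> x _; rewrite lee_fin powR_ge0.
apply: (@le_trans _ _ ((l * m)%:E + (l `^ (1 - P) * K)%:E)).
  rewrite -EFinM leeD2l// EFinM lee_wpmul2l// lee_fin powR_ge0//.
rewrite -EFinD lee_fin powRB ?(gt_eqF l0) ?implybT// powRr1 ?(ltW l0)//.
rewrite lP.
rewrite le_eqVlt; apply/orP; left; apply/eqP; rewrite -/l; field.
by rewrite (gt_eqF m0) (gt_eqF K0).
Qed.

(** As [a] is the average of [H], the function [1 + H / a] has average 2. *)
Lemma integral_le_average (g : X -> R) (a s : R) : measurable_fun setT g ->
  (forall x, 0 <= g x)%R -> (0 < a)%R -> (0 <= s)%R ->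
  \int[mu]_(x in B) (H x)%:E = (a * m)%:E ->
  (forall x, B x -> g x <= s * (1 + H x / a))%R ->
  \int[mu]_(x in B) (g x)%:E <= (2 * s * m)%:E.
Proof.
move=> mg g0 a0 s0 Ha gs.
apply: (@le_trans _ _ (\int[mu]_(x in B) (s%:E + (s / a)%:E * (H x)%:E))).
  apply: ge0_le_integral => //.
  - by move=> x _; rewrite lee_fin.
  - by apply: measurable_funTS; exact/measurable_EFinP.
  - by apply: emeasurable_funD => //; exact: emeasurable_funM.
  - move=> x Bx; rewrite -EFinM -EFinD lee_fin (le_trans (gs _ Bx))//.
    by rewrite mulrDr mulr1 mulrA mulrAC.
have sa0 : (0 <= s / a)%R by rewrite divr_ge0// ltW.
rewrite ge0_integralD//; last 2 first.
- by move=> x Bx; rewrite mule_ge0// HB0.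
- exact: emeasurable_funM.
rewrite ge0_integralZl_EFin// Ha (integral_cst mu mB s%:E) muB.
rewrite -!EFinM -EFinD lee_fin mulrA divfK ?gt_eqF//; lra.
Qed.

End Averages.

(** * Freezing the exponent on a ball *)

Section PointwiseBound.
Context {R : realType} {disp : measure_display} {X : measurableType disp}.
Variables (d : X -> X -> R) (mu : {measure set X -> \bar R}).
Hypothesis hX : homogeneous_type d mu.
Variable x0 : X.

(* The base point decay of [r] is only used through its product with the
   logarithm of the weight; [ri] is moved into the range of [r]. *)
Lemma weight_oscillation (lo hi : R) (r : X -> R) (N : nat) :
  LH_infty d x0 r -> (forall x, lo <= r x <= hi)%R ->
  exists ri c : R, (lo <= ri <= hi)%R /\
    forall x, (`|r x - ri| * - ln (weight d x0 N x) <= c)%R.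
Proof.
move=> [C [ri rC]] lohi.
pose ri' := Num.max lo (Num.min ri hi).
have lh : (lo <= hi)%R by have /andP[] := lohi x0; exact: le_trans.
exists ri', (N%:R * `|C|)%R; split.
  by rewrite /ri' le_max lexx/= ge_max lh ge_min lexx orbT.
move=> x; have /andP[lr rh] := lohi x.
have e1 := ln_expR1D_ge1 hX x0 x.
have l0 : (0 < ln (expR 1 + d x x0))%R by exact: lt_le_trans e1.
rewrite (ln_weight hX) opprK mulrCA ler_wpM2l//.
(* Clamping to [[lo, hi]] does not increase the distance to [r x]. *)
apply: (@le_trans _ _ (`|r x - ri| * ln (expR 1 + d x x0)))%R.
  rewrite ler_wpM2r ?(ltW l0)// /ri'.
  have [h1|h1] := leP ri hi; [have [h2|h2] := leP lo ri|have [h2|h2] := leP lo hi] => //.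
  - by rewrite !ger0_norm; lra.
  - by rewrite !ler0_norm; lra.
  - by move: lh; rewrite leNgt h2.
by rewrite -ler_pdivlMr// (le_trans (rC x))// ler_pM2r ?ler_norm// invr_gt0.
Qed.

(** [Y] depends only on [F], while [t] also depends on the ball; the finite [t] carries the estimate
    because [Y x] may be infinite. The power [1 - eta] of the volume cancels the normalisation in
    [frac_maximal]. *)
Lemma key_estimate (P eta : R) (r : X -> R) :
  (1 < P)%R -> (0 <= eta < 1)%R -> measurable_fun setT r ->
  (forall x, eta <= r x <= P^-1)%R -> LH d x0 r ->
  exists2 C : R, (1 <= C)%R & forall F : X -> R,
    measurable_fun setT F -> (forall x, 0 <= F x)%R -> \int[mu]_x (F x)%:E <= 1 ->
    exists Y : X -> \bar R, [/\ measurable_fun setT Y, forall x, 0 <= Y x,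
      \int[mu]_x Y x <= C%:E &
      forall B x, qballs d B -> B x -> exists t : R, [/\ (0 <= t)%R, t%:E <= Y x &
        \int[mu]_(y in B) (F y `^ r y)%:E <=
          (C * vol mu B `^ (1 - eta) * t `^ (r x - eta))%:E]].
Proof.
move=> P1 eta01 mr rP lh; have /andP[eta0 eta1] := eta01.
have P0 : (0 < P)%R by lra.
have iP0 : (0 < P^-1)%R by rewrite invr_gt0.
have iP1 : (P^-1 <= 1)%R by rewrite invf_le1// ltW.
have [N [K1' wK1']] := weight_integrable hX x0.
pose K1 : R := `|K1'|%R.
have wK1 : \int[mu]_x (weight d x0 N x)%:E <= K1%:E.
  by rewrite (le_trans wK1')// lee_fin ler_norm.
have [K K0 strong] := strong_type hX P1.
have [ri [c [/andP[eri riP] wosc]]] := weight_oscillation N lh.2 rP.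
have [Cr Cr0 osc] := log_oscillation hX lh.
pose w := weight d x0 N; pose e x := (w x `^ P^-1)%R.
have w0 x : (0 < w x)%R by exact: (weight_gt0 hX).
have e0 x : (0 < e x)%R by rewrite powR_gt0.
have e1 x : (e x <= 1)%R.
  apply: (@le_trans _ _ (1 `^ P^-1)%R); last by rewrite powR1.
  apply: ge0_ler_powR; rewrite ?nnegrE ?(ltW (w0 _)) ?(ltW iP0)//.
  exact: (weight_le1 hX).
have eP x : (e x `^ P = w x)%R by rewrite -powRrM mulVf ?gt_eqF// powRr1// ltW.
have eosc x : (`|r x - ri| * (P * - ln (e x)) <= c)%R.
  by rewrite ln_powR -mulrN mulVKf ?gt_eqF//.
have mw : measurable_fun setT w by exact: (measurable_weight hX).
have tP2 : (0 < 2 `^ P :> R)%R by exact: powR_gt0.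
(* Bounds the integral of [H^P], since [F] and [w] have integrals at most 1 and [K1]. *)
pose KH : R := (2 `^ P * (1 + K1))%R.
have K10 : (0 <= K1)%R by exact: normr_ge0.
have KH0 : (0 < KH)%R by rewrite mulr_gt0//; lra.
(* [average_le] gives a^P m <= 2^P KH; the added 1 ensures [K2 >= 1]. *)
pose K2 : R := (2 `^ P * KH + 1)%R.
have K21 : (1 <= K2)%R by rewrite lerDr mulr_ge0// ltW.
(* The summands come from the cases [a >= 1] and [a < 1]. *)
pose C0 : R := (K2 * expR Cr * K2 + expR c * (K2 * (2 `^ P * expR c)))%R.
have C0a : (K2 * expR Cr * K2 <= C0)%R.
  by rewrite /C0 lerDl !mulr_ge0 ?expR_ge0// ?(ltW tP2)// (le_trans ler01).
have C0b : (expR c * (K2 * (2 `^ P * expR c)) <= C0)%R.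
  by rewrite /C0 lerDr !mulr_ge0 ?expR_ge0// (le_trans ler01).
have C00 : (0 <= C0)%R.
  by rewrite (le_trans _ C0a)// !mulr_ge0 ?expR_ge0// (le_trans ler01).
pose CY : R := (2 `^ P * (K * KH + K1))%R.
have CY0 : (0 <= CY)%R.
  by rewrite mulr_ge0 ?(ltW tP2)// addr_ge0// mulr_ge0 ?(ltW K0) ?(ltW KH0).
exists (2 * C0 + CY + 1)%R; first by clear -C00 CY0; lra.
move=> F mF F0 IF.
pose H y := (F y `^ P^-1 + e y)%R.
have H0 y : (0 < H y)%R by rewrite ltr_wpDl// powR_ge0.
have H0' y : (0 <= H y)%R by exact: ltW.
have mH : measurable_fun setT H.
  apply: measurable_funD; first exact: (measurableT_comp (measurable_powR _) mF).
  exact: (measurableT_comp (measurable_powR _) mw).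
have mHP : measurable_fun setT (fun x => (H x `^ P)%:E).
  by apply/measurable_EFinP; exact: (measurableT_comp (measurable_powR P)).
have mFE : measurable_fun setT (fun x => (F x)%:E) by exact/measurable_EFinP.
have mwE : measurable_fun setT (fun x => (w x)%:E) by exact/measurable_EFinP.
have HP : \int[mu]_x (H x `^ P)%:E <= KH%:E.
  apply: (@le_trans _ _ (\int[mu]_x ((2 `^ P)%:E * ((F x)%:E + (w x)%:E)))).
    apply: ge0_le_integral => //.
    - by move=> x _; rewrite lee_fin powR_ge0.
    - by apply: emeasurable_funM => //; exact: emeasurable_funD.
    move=> x _; rewrite -EFinD -EFinM lee_fin -eP.
    rewrite -[in leRHS](_ : (F x `^ P^-1) `^ P = F x)%R.
      by apply: powRD_le => //; [exact: powR_ge0|exact: ltW].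
    by rewrite -powRrM mulVf ?gt_eqF// powRr1.
  rewrite ge0_integralZl_EFin ?(ltW tP2)//; last 2 first.
  - by move=> x _; rewrite adde_ge0 ?lee_fin// ltW.
  - exact: emeasurable_funD.
  rewrite ge0_integralD//; last 2 first.
  - by move=> x _; rewrite lee_fin.
  - by move=> x _; rewrite lee_fin ltW.
  by rewrite /KH EFinM lee_pmul2l// EFinD leeD.
have [W [mW W0 WB IW]] := strong H mH (fun x => ltW (H0 x)).
exists (fun x => (2 `^ P)%:E * (W x + (w x)%:E)); split.
- by apply: emeasurable_funM => //; exact: emeasurable_funD.
- by move=> x; rewrite mule_ge0 ?adde_ge0 ?lee_fin// ltW.
- rewrite ge0_integralZl_EFin ?(ltW tP2)//; last 2 first.
  + by move=> x _; rewrite adde_ge0 ?lee_fin// ltW.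
  + exact: emeasurable_funD.
  rewrite ge0_integralD//; last by move=> x _; rewrite lee_fin ltW.
  apply: (@le_trans _ _ CY%:E).
    rewrite /CY EFinM lee_pmul2l// EFinD leeD//.
    by rewrite (le_trans IW)// EFinM lee_pmul2l.
  by rewrite lee_fin; clear -C00 CY0; lra.
move=> B x dB Bx.
have mB := measurable_qballs hX dB; have muB := volE hX dB; have m0 := vol_gt0 hX dB.
pose m : R := vol mu B; rewrite -/m in muB m0 *.
pose IB := \int[mu]_(y in B) (H y)%:E.
have IB0 : 0 < IB by exact: (average_gt0 mB muB m0 mH H0' H0).
have Kmp : (0 < (KH / m) `^ P^-1)%R by apply: powR_gt0; exact: divr_gt0.
have IBle : IB <= (2 * (KH / m) `^ P^-1 * m)%:E.
  exact: (average_le mB muB m0 mH H0' P1 KH0 HP).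
have IBf : IB \is a fin_num.
  by rewrite ge0_fin_numE ?(ltW IB0)// (le_lt_trans IBle)// ltry.
pose a : R := (fine IB / m)%R.
have a0 : (0 < a)%R by apply: divr_gt0 => //; rewrite fine_gt0// IB0 ltey_eq IBf.
have aE : IB = (a * m)%:E by rewrite /a divfK ?gt_eqF// fineK.
have am : (a `^ P * m <= K2)%R.
  move: IBle; rewrite aE lee_fin ler_pM2r// => ale.
  apply: (@le_trans _ _ ((2 * (KH / m) `^ P^-1) `^ P * m))%R.
    rewrite ler_pM2r//; apply: ge0_ler_powR => //; rewrite ?nnegrE ?(ltW P0) ?(ltW a0)//.
    by rewrite mulr_ge0// ltW.
  rewrite powRM ?(ltW Kmp)// -[X in (_ * X * _)%R]powRrM mulVf ?gt_eqF//.
  rewrite powRr1; last by rewrite divr_ge0// ltW.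
  by rewrite -mulrA divfK ?gt_eqF// /K2 lerDl.
have [s [s0 Fs sm]] : exists s, [/\ (0 <= s)%R,
    (forall y, B y -> F y `^ r y <= s * (1 + H y / a))%R &
    (s * m `^ eta <= C0 * (a + e x) `^ (P * (r x - eta)))%R].
  have FE y : (F y `^ r y = (F y `^ P^-1) `^ (P * r y))%R.
    by rewrite -powRrM mulrA mulVf ?gt_eqF// mul1r.
  have r0P y : (0 <= r y <= P^-1)%R.
    by have /andP[r1 r2] := rP y; rewrite r2 (le_trans eta0).
  have Pre : (0 <= P * (r x - eta))%R.
    by have /andP[r1 _] := rP x; rewrite mulr_ge0 ?(ltW P0)// subr_ge0.
  have [a1|a1] := leP 1%R a.
    exists (K2 * expR Cr * a `^ (P * r x))%R; split.
    - by rewrite mulr_ge0 ?powR_ge0// mulr_ge0 ?expR_ge0//; clear -K21; lra.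
    - move=> y By; rewrite FE.
      apply: (@le_trans _ _ (K2 * expR Cr * a `^ (P * r x) * (1 + F y `^ P^-1 / a)))%R.
        apply: (large_average P1 K21 a0 m0 am) => //; first exact: powR_ge0.
        exact: (osc _ _ _ dB By Bx).
      rewrite ler_wpM2l//.
        by rewrite mulr_ge0 ?powR_ge0// mulr_ge0 ?expR_ge0//; clear -K21; lra.
      by rewrite lerD2l ler_pM2r ?invr_gt0// lerDl ltW.
    - apply: (@le_trans _ _ (K2 * expR Cr * K2 * (a + e x) `^ (P * (r x - eta))))%R; last first.
        by rewrite ler_wpM2r// powR_ge0.
      have K2e : (0 <= K2 * expR Cr)%R by rewrite mulr_ge0 ?expR_ge0//; clear -K21; lra.
      rewrite -!mulrA mulrA [leRHS]mulrA ler_wpM2l// mulrC.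
      rewrite (le_trans (powR_vol_le P1 eta01 K21 a0 m0 am _))// ler_wpM2l//.
        by clear -K21; lra.
      apply: ge0_ler_powR => //; rewrite ?nnegrE ?(ltW a0) ?addr_ge0 ?(ltW (e0 _)) ?(ltW a0)//.
      by rewrite lerDl ltW.
  have rie : (0 <= ri <= P^-1)%R by rewrite riP (le_trans eta0).
  exists (expR c * a `^ (P * ri))%R; split.
  - by rewrite mulr_ge0 ?powR_ge0 ?expR_ge0.
  - move=> y By; rewrite FE.
    by apply: (small_average P1 a0) => //; exact: powR_ge0.
  - apply: (@le_trans _ _ (expR c * (K2 * (2 `^ P * expR c)) * (a + e x) `^ (P * (r x - eta))))%R; last first.
      by rewrite ler_wpM2r// powR_ge0.
    rewrite -!mulrA ler_wpM2l ?expR_ge0// mulrC.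
    rewrite (le_trans (powR_vol_le P1 eta01 K21 a0 m0 am _))// ler_wpM2l//.
      by clear -K21; lra.
    rewrite mulrA; apply: (recenter_exponent P1 eta01 a0) => //.
    by rewrite eri riP.
(* This [t] is at least (a + e(x))^P by [powRD_le], and at most [Y x] because a^P <= W(x). *)
exists (2 `^ P * (a `^ P + w x))%R; split.
- by rewrite mulr_ge0 ?addr_ge0 ?powR_ge0// ltW.
- rewrite EFinM lee_pmul2l// EFinD leeD2r//.
  by apply: (WB B x a) => //; [exact: ltW|rewrite muB -EFinM -aE].
apply: (@le_trans _ _ (2 * s * m)%:E).
  apply: (integral_le_average mB muB mH H0' _ _ a0 s0 aE Fs) => //.
  - exact: measurable_fun_powR2.
  - by move=> y; exact: powR_ge0.
rewrite lee_fin.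
have ate : ((a + e x) `^ (P * (r x - eta)) <= (2 `^ P * (a `^ P + w x)) `^ (r x - eta))%R.
  rewrite powRrM -eP; apply: ge0_ler_powR; rewrite ?nnegrE ?powR_ge0//.
  - by have /andP[r1 _] := rP x; rewrite subr_ge0.
  - by rewrite mulr_ge0 ?addr_ge0 ?powR_ge0.
  - by apply: powRD_le => //; exact: ltW.
have mE : (m = m `^ eta * m `^ (1 - eta))%R.
  by rewrite -powRD ?(gt_eqF m0) ?implybT// [(eta + _)%R]addrC subrK powRr1// ltW.
rewrite {1}mE.
have m1 : (0 <= m `^ (1 - eta))%R by exact: powR_ge0.
set T := (X in (_ <= _ * _ * X)%R); set T' := (X in (_ <= X)%R) in ate.
have T0 : (0 <= T)%R by exact: powR_ge0.
apply: (@le_trans _ _ (2 * (C0 * T) * m `^ (1 - eta)))%R.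
  rewrite !mulrA ler_wpM2r// -!mulrA ler_pM2l// (le_trans sm)//.
  by rewrite ler_wpM2l.
rewrite [leRHS]mulrAC ler_wpM2r// mulrA ler_wpM2r//.
by clear -C00 CY0; lra.
Qed.

End PointwiseBound.

(** * Log-Hoelder continuity in measure *)

(* Nothing is assumed measurable: balls need not be open, so [frac_maximal] might
   not be measurable. *)
Lemma ge0_le_integral_setT {disp : measure_display} {X : measurableType disp}
    {R : realType} (mu : {measure set X -> \bar R}) (f g : X -> \bar R) :
  (forall x, 0 <= f x) -> (forall x, f x <= g x) ->
  \int[mu]_x f x <= \int[mu]_x g x.
Proof.
move=> f0 fg; have g0 x : 0 <= g x by exact: le_trans (fg x).
rewrite !ge0_integralTE//; apply: le_ereal_sup => _ /= [h hf <-].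
by exists h => // x; exact: le_trans (fg x).
Qed.

Section Bounds.
Context {R : realType} {disp : measure_display} {X : measurableType disp}.
Variables (d : X -> X -> R) (mu : {measure set X -> \bar R}).
Hypothesis hX : homogeneous_type d mu.
Variable x0 : X.

(* If [X] is unbounded, the ball about [x0] of radius comparable to [d x0 x] is
   disjoint from a ball about [x] of comparable measure, so that the measure of
   every ball about [x0] is at most a fixed fraction of that of [X]. *)
Lemma finite_measure_bounded : mu setT < +oo ->
  exists D : R, forall x, (d x0 x <= D)%R.
Proof.
move=> muT; apply: contrapT => unb.
have {}unb (D : R) : exists x, (D < d x0 x)%R.
  apply: contrapT => h; apply: unb; exists D => x.
  by rewrite leNgt; apply/negP => Dx; apply: h; exists x.
have [A A1 tri] := qd_triangle hX.
have A0 : (0 < A)%R by exact: lt_le_trans A1.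
(* When [d x0 x = 2 * A * rho], the balls of radius [rho] about [x0] and [x] are disjoint, and this
   dilation of the second contains the first. *)
have [C C1 dil] := doubling_dilate hX (A * (2 * A + 1)).
have C0 : (0 < C)%R by exact: lt_le_trans C1.
have muTf : mu setT \is a fin_num by rewrite ge0_fin_numE.
pose v := fine (mu setT); have vE : mu setT = v%:E by rewrite fineK.
have le_v n : ((1 + C^-1) * vol mu (qball d x0 n.+1%:R) <= v)%R.
  have [x nx] := unb (2 * A * n.+1%:R)%R.
  pose rho := (d x0 x / (2 * A))%R.
  have A20 : (0 < 2 * A)%R by rewrite mulr_gt0.
  have nrho : (n.+1%:R <= rho)%R by rewrite ler_pdivlMr// mulrC ltW.
  have rho0 : (0 < rho)%R by exact: lt_le_trans nrho.
  have dE : d x0 x = (2 * A * rho)%R by rewrite mulrC divfK// gt_eqF.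
  have disj : qball d x0 rho `&` qball d x rho = set0.
    rewrite -subset0 => y [/= x0y xy]; have := tri x0 x y.
    rewrite leNgt => /negP; apply; rewrite dE -mulrA mulrCA ltr_pM2l//.
    by rewrite mulr2n mulrDl mul1r; exact: ltrD.
  have far : (vol mu (qball d x0 rho) <= C * vol mu (qball d x rho))%R.
    have K0 : (0 < A * (2 * A + 1))%R by rewrite mulr_gt0// addr_gt0.
    apply: le_trans (dil x rho rho0 K0); apply: (le_vol hX).
    - exact: qballs_qball.
    - by apply: qballs_qball; rewrite mulr_gt0.
    move=> y; rewrite /qball/= => x0y; apply: (le_lt_trans (tri _ _ x0)).
    rewrite (qd_sym hX x x0) (qd_sym hX y x0) -mulrA ltr_pM2l// dE.
    by rewrite mulrDl; lra.
  have near : (vol mu (qball d x0 n.+1%:R) <= vol mu (qball d x0 rho))%R.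
    by apply: (le_vol hX); [exact: qballs_qball|exact: qballs_qball|exact: subset_qball].
  have sum : (vol mu (qball d x0 rho) + vol mu (qball d x rho) <= v)%R.
    rewrite -lee_fin EFinD -(volE hX (qballs_qball d x0 rho0)).
    rewrite -(volE hX (qballs_qball d x rho0)).
    rewrite -measureU//; try exact: (measurable_qball hX).
    rewrite -vE; apply: le_measure; rewrite ?inE//.
    by apply: measurableU; exact: (measurable_qball hX).
  have far' : (C^-1 * vol mu (qball d x0 rho) <= vol mu (qball d x rho))%R.
    by rewrite ler_pdivrMl.
  apply: le_trans sum; rewrite mulrDl mul1r; apply: lerD => //.
  by apply: le_trans far'; rewrite ler_pM2l// invr_gt0.
have c1 : (0 < 1 + C^-1)%R by rewrite addr_gt0// invr_gt0.
(* Exhausting [X] by balls about [x0] makes [v] at most a proper fraction of itself. *)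
have : mu setT <= ((1 + C^-1)^-1 * v)%:E.
  apply: (le_mu_setT hX (c := x0)) => n.
  by rewrite (volE hX); [rewrite lee_fin ler_pdivlMl|exact: qballs_qball].
rewrite vE lee_fin leNgt => /negP; apply.
have v0 : (0 < v)%R.
  apply: lt_le_trans (le_v 0%N); rewrite mulr_gt0//.
  by apply: (vol_gt0 hX); exact: qballs_qball.
by rewrite ltr_pdivrMl// mulrDl mul1r ltrDl mulr_gt0// invr_gt0.
Qed.

(** On a bounded space the logarithm in [LH_infty] is bounded, so the limit value 0 serves for any
    [r] with values in [0, 1]. *)
Lemma finite_measure_LH_infty (r : X -> R) : mu setT < +oo ->
  (forall x, 0 <= r x <= 1)%R -> LH_infty d x0 r.
Proof.
move=> /finite_measure_bounded[D dD] r01.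
exists (ln (expR 1 + D)), 0%R => x; rewrite subr0.
have /andP[r0 r1] := r01 x; have e1 := ln_expR1D_ge1 hX x0 x.
rewrite ger0_norm// (le_trans r1)// ler_pdivlMr ?mul1r ?(lt_le_trans _ e1)//.
have dx : (expR 1 + d x x0 <= expR 1 + D)%R by rewrite lerD2l (qd_sym hX).
have ed0 : (0 < expR 1 + d x x0)%R by rewrite ltr_wpDr ?expR_gt0// (qd_ge0 hX).
by rewrite ler_ln// posrE// (lt_le_trans ed0).
Qed.

(** If [r x > c], the log-Hoelder modulus keeps [r] above [c] on a whole ball about [x], and balls
    have positive measure. *)
Lemma LH0_ae_le (r : X -> R) (c : R) : LH0 d r ->
  {ae mu, forall x, r x <= c}%R -> forall x, (r x <= c)%R.
Proof.
move=> [C0 lh] ae_c x; rewrite leNgt; apply/negP => cx.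
pose eps := (r x - c)%R; have eps0 : (0 < eps)%R by rewrite subr_gt0.
have ln2 := @ln2_gt0 R.
(* The first summand makes the oscillation on the ball less than [eps], the second makes its radius
   less than 1/2. *)
pose L := (`|C0| / eps + 2 * ln 2)%R.
have Ce0 : (0 <= `|C0| / eps)%R by rewrite divr_ge0// ltW.
have L0 : (0 < L)%R by rewrite ltr_wpDl// mulr_gt0.
have delta0 : (0 < expR (- L))%R by exact: expR_gt0.
have delta12 : (expR (- L) < 1 / 2)%R.
  have -> : (1 / 2 = expR (- ln 2) :> R)%R by rewrite expRN lnK ?posrE// div1r.
  by rewrite ltr_expR ltrN2 /L; lra.
have ballc y : qball d x (expR (- L)) y -> ~ (r y <= c)%R.
  rewrite /qball/= => xy; apply/negP; rewrite -ltNge.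
  have [<-//|/eqP xNy] := eqVneq x y.
  have dxy0 : (0 < d x y)%R.
    rewrite lt_def (qd_ge0 hX) andbT; apply/eqP => dxy; apply: xNy.
    by have [_ h _ _] := homogeneous_quasi_metric hX; apply/h.
  have lnd : (L < - ln (d x y))%R.
    by rewrite ltrNr -[ltRHS]expRK ltr_ln ?posrE ?expR_gt0.
  have lnd0 : (0 < - ln (d x y))%R by exact: lt_trans lnd.
  have := lh _ _ xNy (lt_trans xy delta12).
  rewrite mulNr -mulrN -invrN ler_pdivlMr// => h.
  have h1 : (`|C0| < eps * L)%R.
    by rewrite /L mulrDr mulrCA divff ?gt_eqF// mulr1 ltrDl !mulr_gt0.
  have h2 : (`|r x - r y| < eps)%R.
    rewrite -(ltr_pM2r lnd0) (le_lt_trans h)// (le_lt_trans (ler_norm _))//.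
    by rewrite (lt_trans h1)// ltr_pM2l.
  by move: h2 => /ltr_normlW; rewrite /eps; lra.
have : mu.-negligible (qball d x (expR (- L))).
  by apply: negligibleS ae_c => y /ballc.
move=> /(measure_negligible (measurable_qball hX _ _)) mu0.
have := homogeneous_ball hX (qballs_qball d x delta0).
by move=> /andP[+ _]; rewrite [X in 0 < X]mu0 ltxx.
Qed.

Lemma LH0_ae_ge (r : X -> R) (c : R) : LH0 d r ->
  {ae mu, forall x, c <= r x}%R -> forall x, (c <= r x)%R.
Proof.
move=> [C0 lh] ae_c x; rewrite -lerN2.
apply: (@LH0_ae_le (fun y => - r y)%R).
  exists C0 => y z yz dyz; rewrite -opprD normrN; exact: lh.
by apply: filterS ae_c => y; rewrite lerN2.
Qed.

End Bounds.

(** * Modulars and norms *)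

Section UnitBall.
Context {R : realType} {disp : measure_display} {X : measurableType disp}.
Variables (mu : {measure set X -> \bar R}).
Variables (p : X -> \bar R) (r : X -> R).
Hypotheses (muT : 0 < mu setT) (mr : measurable_fun setT r)
  (r0 : forall x, (0 <= r x)%R) (rE : forall x, (p x)^-1 = (r x)%:E).

Lemma exponentE x : p x = if r x == 0%R then +oo else (r x)^-1%:E.
Proof. by rewrite -[p x]inveK rE inver. Qed.

Let OmegaP x : Omega_infty p x <-> r x = 0%R.
Proof.
rewrite /Omega_infty/= exponentE; split=> [|->]; last by rewrite eqxx.
by case: eqVneq.
Qed.

Let mOmegaC : measurable (~` Omega_infty p).
Proof.
apply: measurableC; rewrite (_ : Omega_infty p = setT `&` r @^-1` [set 0%R]).
  exact: mr.
by rewrite setTI; apply/seteqP; split => x /OmegaP.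
Qed.

Lemma modular_unit_ball (u : X -> \bar R) : measurable_fun setT u ->
  modular mu p u <= 1 ->
  exists F : X -> R, [/\ measurable_fun setT F, forall x, (0 <= F x)%R,
    \int[mu]_x (F x)%:E <= 1 &
    {ae mu, forall x, `|u x| <= (F x `^ r x)%:E}].
Proof.
move=> mu_ modu.
pose I := \int[mu]_(x in ~` Omega_infty p) (`|u x| `^ fine (p x)).
pose L := 'N[mu]_+oo [u \_ (Omega_infty p)].
have I0 : 0 <= I by apply: integral_ge0 => x _; exact: poweR_ge0.
have L0 : 0 <= L by exact: Lnorm_ge0.
have I1 : I <= 1 by rewrite (le_trans _ modu)// leeDl.
have L1 : L <= 1 by rewrite (le_trans _ modu)// leeDr.
have {}I1 : \int[mu]_x ((fun x => `|u x| `^ fine (p x)) \_ (~` Omega_infty p)) x <= 1.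
  by rewrite -integral_mkcond.
(* [F] is |u|^p where [p] is finite. Where [r x = 0], the convention 0^0 = 1 gives the bound 1
   supplied by the essential supremum, and the value 0 adds nothing to the integral. *)
pose F x : R := if r x == 0%R then 0%R else (fine `|u x| `^ (r x)^-1)%R.
have F0 x : (0 <= F x)%R by rewrite /F; case: ifP => // _; exact: powR_ge0.
have mabs : measurable_fun setT (fun x => `|u x|) by exact: measurableT_comp.
have OmegaN x : r x != 0%R -> (x \in ~` Omega_infty p) = true.
  by move=> /eqP rx; rewrite mem_set//= => /OmegaP.
(* At an infinite value [fine] returns 0 and [F] gives no bound; [+oo * mu A <= 1] shows that such
   points are negligible. *)
have finu : {ae mu, forall x, r x != 0%R -> `|u x| \is a fin_num}.
  pose A := [set x | r x != 0%R /\ `|u x| = +oo].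
  have mA : measurable A.
    have -> : A = ~` Omega_infty p `&` ([set: X] `&` (fun x => `|u x|) @^-1` [set +oo]).
      rewrite setTI; apply/seteqP; split => x /= [rx ux]; split=> //.
        by move=> /OmegaP /eqP; apply/negP.
      by apply/negP => /eqP /OmegaP.
    by apply: measurableI => //; apply: mabs.
  exists A; split=> //; last first.
    move=> x /= /not_implyP[rx ufin]; split=> //.
    by apply/eqP; rewrite -leye_eq leNgt -ge0_fin_numE//; exact/negP.
  have : +oo * mu A <= 1.
    rewrite -(integral_cst mu mA +oo) integral_mkcond (le_trans _ I1)//.
    apply: ge0_le_integral_setT => x; rewrite !patchE.
      by case: ifP => //= _; rewrite le0y.
    case: ifPn => [|_]; last by case: ifP => // _; exact: poweR_ge0.
    rewrite inE => -[rx ux]; rewrite OmegaN// ux exponentE (negbTE rx).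
    by rewrite poweRyr// invr_neq0.
  have [->//|A0] := eqVneq (mu A) 0.
  by rewrite gt0_mulye// lt0e A0/=.
exists F; split=> //.
- apply: measurable_fun_ifT => //; first exact: measurable_fun_eqr.
  apply: measurable_fun_powR2; first exact: (measurableT_comp _ mabs).
  have -> : (fun x => (r x)^-1)%R = (fun x => r x `^ (-1))%R.
    by apply/funext => x; rewrite powR_inv1.
  exact: (measurableT_comp (measurable_powR _) mr).
- apply: le_trans I1; apply: ge0_le_integral_setT => x.
    by rewrite lee_fin.
  rewrite /F; case: eqVneq => rx.
    by rewrite patchE; case: ifP => // _; exact: poweR_ge0.
  rewrite patchE OmegaN// exponentE (negbTE rx).
  case: `|u x| (abse_ge0 (u x)) => [v _|_|//]; first by rewrite poweR_EFin.
  by rewrite [fine +oo]/(0%R) powR0 ?invr_neq0// poweR_ge0.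
- have ubd : {ae mu, forall x, `|(u \_ (Omega_infty p)) x| <= 1}.
    move: L1; rewrite /L unlock /= muT => /ess_supP; exact.
  apply: filterS2 finu ubd => x xfin xbd.
  have [rx|rx] := eqVneq (r x) 0%R.
    move: xbd; rewrite patchE mem_set/=; last exact/OmegaP.
    by rewrite rx powRr0.
  rewrite /F (negbTE rx) -powRrM mulVf// powRr1; last by rewrite fine_ge0.
  by rewrite fineK// xfin.
Qed.

End UnitBall.

(** * From the modular to the norm *)

Section FractionalMaximal.
Context {R : realType} {disp : measure_display} {X : measurableType disp}.
Variables (d : X -> X -> R) (mu : {measure set X -> \bar R}).
Hypothesis hX : homogeneous_type d mu.

Lemma frac_maximal_ge0 (eta : R) f x : 0 <= frac_maximal d mu eta f x.
Proof.
apply: (@le_trans _ _ (mu (qball d x 1) `^ eta *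
    ((mu (qball d x 1))^-1 * \int[mu]_(y in qball d x 1) `|f y|))).
  rewrite mule_ge0 ?poweR_ge0// mule_ge0 ?inve_ge0//.
  by apply: integral_ge0.
apply: ereal_sup_ubound; exists (qball d x 1) => //; split.
  exact: qballs_qball.
exact: (qball_center hX).
Qed.

Lemma frac_maximal_le (eta : R) (f : X -> \bar R) (x : X) (M : \bar R) :
  (forall B, qballs d B -> B x ->
    ((vol mu B `^ eta / vol mu B)%:E * \int[mu]_(y in B) `|f y| <= M)) ->
  frac_maximal d mu eta f x <= M.
Proof.
move=> BM; apply: ge_ereal_sup => _ [B [dB Bx] <-].
have v0 := vol_gt0 hX dB.
by rewrite (volE hX dB) poweR_EFin inver gt_eqF// muleA -EFinM BM.
Qed.

(** With |f|/l <= F^r almost everywhere, [key_estimate] bounds M_eta f by C l Y^(1/q) pointwise, and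
    the integral of [Y] controls the modular of Y^(1/q). *)
Lemma modular_frac_maximal (P eta : R) (p q : X -> \bar R) (r : X -> R) (x0 : X) :
  (1 < P)%R -> (0 <= eta < 1)%R -> measurable_fun setT r ->
  (forall x, eta <= r x <= P^-1)%R -> LH d x0 r ->
  (forall x, (p x)^-1 = (r x)%:E) -> (forall x, (q x)^-1 = (r x - eta)%:E) ->
  exists2 C : R, (0 < C)%R & forall (f : X -> \bar R) (l : R),
    measurable_fun setT f -> (0 < l)%R -> modular mu p (scale_inv f l) <= 1 ->
    modular mu q (scale_inv (frac_maximal d mu eta f) (C * l)) <= 1.
Proof.
move=> P1 eta01 mr rP lh pE qE.
have [C C1 key] := key_estimate hX P1 eta01 mr rP lh.
have C0 : (0 < C)%R by exact: lt_le_trans C1.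
have /andP[eta0 eta1] := eta01.
(* The extra factor [2 * C] leaves 1/2 for each part of the modular: as [q >= 1], the power [q] of
   [(2 * C)^-1] is at most [(2 * C)^-1], while [Y] has integral at most [C]; where [q] is infinite,
   [(2 * C)^-1 <= 1/2] suffices. *)
pose C' : R := (2 * C * C)%R.
have C'0 : (0 < C')%R by rewrite !mulr_gt0.
have CC' : (C / C' = (2 * C)^-1)%R by rewrite /C'; field; rewrite gt_eqF.
exists C' => // f l mf l0 mod1.
have r0 x : (0 <= r x)%R by have /andP[? _] := rP x; exact: le_trans eta0 _.
have s0 x : (0 <= r x - eta)%R by have /andP[? _] := rP x; rewrite subr_ge0.
have s1 x : (r x - eta <= 1)%R.
  have /andP[_ h] := rP x; have : (P^-1 <= 1)%R by rewrite invf_le1 ?ltW//; lra.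
  lra.
have muT : 0 < mu setT.
  have := homogeneous_ball hX (qballs_qball d x0 ltr01) => /andP[h _].
  apply: lt_le_trans h _; apply: le_measure; rewrite ?inE//.
  exact: (measurable_qball hX).
pose u := scale_inv f l.
have lE : (l%:E)^-1 = (l^-1)%:E by rewrite inver gt_eqF.
have mu_ : measurable_fun setT u.
  by rewrite /u /scale_inv lE; exact: emeasurable_funM.
have fu y : `|f y| = l%:E * `|u y|.
  rewrite /u /scale_inv lE abseM [`|(l^-1)%:E|]gee0_abs; last first.
    by rewrite lee_fin invr_ge0 ltW.
  by rewrite muleCA -EFinM divff ?gt_eqF// mule1.
have [F [mF F0 IF uF]] := modular_unit_ball muT mr r0 pE mu_ mod1.
have [Y [mY Y0 IY FY]] := key F mF F0 IF.
have Mle x : frac_maximal d mu eta f x <= (C * l)%:E * (Y x `^ (r x - eta)).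
  apply: frac_maximal_le => B dB Bx.
  have m0 := vol_gt0 hX dB; set m := vol mu B in m0 *.
  have [t [t0 tY Ft]] := FY _ _ dB Bx.
  have mB := measurable_qballs hX dB.
  have fB : \int[mu]_(y in B) `|f y| <=
      (l * (C * m `^ (1 - eta) * t `^ (r x - eta)))%:E.
    under eq_integral do rewrite fu.
    rewrite ge0_integralZl_EFin ?(ltW l0)//; last first.
      by apply: measurable_funTS; exact: measurableT_comp.
    rewrite EFinM lee_pmul2l//; apply: le_trans Ft.
    apply: ae_ge0_le_integral => //.
    - by apply: measurable_funTS; exact: measurableT_comp.
    - by move=> y _; rewrite lee_fin powR_ge0.
    - apply: measurable_funTS; apply/measurable_EFinP.
      exact: measurable_fun_powR2.
    - by apply: filterS uF => y.
  have mm : (0 < m `^ eta / m)%R by rewrite divr_gt0// powR_gt0.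
  apply: (@le_trans _ _ ((m `^ eta / m)%:E *
      (l * (C * m `^ (1 - eta) * t `^ (r x - eta)))%:E)).
    by rewrite lee_pmul2l.
  have -> : ((m `^ eta / m)%:E * (l * (C * m `^ (1 - eta) * t `^ (r x - eta)))%:E =
      (C * l)%:E * (t `^ (r x - eta))%:E).
    rewrite -!EFinM; congr (_%:E).
    rewrite (@powRB _ m) ?(gt_eqF m0) ?implybT// powRr1 ?(ltW m0)//.
    by field; rewrite (gt_eqF m0)/= gt_eqF// powR_gt0.
  rewrite lee_pmul2l ?lte_fin ?mulr_gt0//.
  rewrite -poweR_EFin; apply: gt0_ler_poweR => //; rewrite in_itv/= ?leey ?andbT//.
pose g := scale_inv (frac_maximal d mu eta f) (C' * l).
have C'l0 : (0 < C' * l)%R by rewrite mulr_gt0.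
have gle x : `|g x| <= ((2 * C)^-1)%:E * Y x `^ (r x - eta).
  have g0 : 0 <= g x.
    by rewrite /g /scale_inv mule_ge0 ?frac_maximal_ge0// inve_ge0 lee_fin ltW.
  rewrite gee0_abs// /g /scale_inv inver gt_eqF// muleC lee_pdivrMl//.
  rewrite (le_trans (Mle x))// muleA -EFinM -CC'.
  suff -> : (C' * l * (C / C') = C * l)%R by [].
  by field; rewrite (gt_eqF C'0).
have C2 : (0 < (2 * C)^-1)%R by rewrite invr_gt0 mulr_gt0.
have C21 : ((2 * C)^-1 <= 1 / 2)%R.
  by rewrite invfM mul1r -[leRHS]mulr1 ler_pM2l ?invr_gt0// invf_le1.
have qx x : q x = if (r x - eta == 0)%R then +oo else ((r x - eta)^-1)%:E.
  exact: (exponentE qE).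
have half : (1 / 2 + 1 / 2)%:E = 1 :> \bar R by congr (_%:E); field.
rewrite -[leRHS]half EFinD; apply: leeD.
  rewrite integral_mkcond.
  apply: (@le_trans _ _ (\int[mu]_x (((2 * C)^-1)%:E * Y x))).
    apply: ge0_le_integral_setT => x; rewrite patchE.
      by case: ifP => // _; exact: poweR_ge0.
    case: ifPn => [|_]; last by rewrite mule_ge0// lee_fin ltW.
    rewrite inE /Omega_infty/= qx; case: eqVneq => // sx _ /=.
    have {}sx : (0 < r x - eta)%R by rewrite lt_def sx s0.
    have is1 : (1 <= (r x - eta)^-1)%R by rewrite invf_ge1.
    apply: (@le_trans _ _
        ((((2 * C)^-1)%:E * Y x `^ (r x - eta)) `^ (r x - eta)^-1)).
      apply: gt0_ler_poweR; rewrite ?in_itv/= ?leey ?andbT ?invr_ge0//.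
      by rewrite mule_ge0 ?poweR_ge0// lee_fin ltW.
    rewrite poweRM ?poweR_ge0 ?lee_fin ?(ltW C2)// -poweRrM divff ?gt_eqF//.
    rewrite poweRe1// lee_wpmul2r// poweR_EFin lee_fin.
    by apply: ge1r_powR => //; rewrite C2/=; lra.
  rewrite ge0_integralZl_EFin ?(ltW C2)//.
  apply: (@le_trans _ _ (((2 * C)^-1)%:E * C%:E)); first by rewrite lee_pmul2l.
  by rewrite -EFinM lee_fin le_eqVlt; apply/orP; left; apply/eqP; field; rewrite gt_eqF.
rewrite unlock /= muT; apply/ess_supP; apply: nearW => x /=.
rewrite patchE; case: ifPn => [|_]; last by rewrite abse0 lee_fin divr_ge0.
rewrite inE /Omega_infty/= qx; case: eqVneq => // sx _.
by rewrite (le_trans (gle x))// sx poweRe0 mule1 lee_fin.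
Qed.

Lemma var_norm_frac_maximal (C eta : R) (p q f : X -> \bar R) : (0 < C)%R ->
  (forall l : R, (0 < l)%R -> modular mu p (scale_inv f l) <= 1 ->
    modular mu q (scale_inv (frac_maximal d mu eta f) (C * l)) <= 1) ->
  var_norm mu q (frac_maximal d mu eta f) <= C%:E * var_norm mu p f.
Proof.
move=> C0 mod; rewrite -lee_pdivrMl//.
apply: le_ereal_inf_tmp => _ [l [l0 fl] <-].
rewrite lee_pdivrMl// -EFinM; apply: ereal_inf_lbound.
by exists (C * l)%R => //; split; [exact: mulr_gt0|exact: mod].
Qed.

End FractionalMaximal.

(** * Regularity and bounds of [1/p] *)

Section Exponent.
Context {R : realType} {disp : measure_display} {X : measurableType disp}.
Variables (d : X -> X -> R) (mu : {measure set X -> \bar R}).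
Hypothesis hX : homogeneous_type d mu.
Variables (p : X -> \bar R).
Hypotheses (mp : measurable_fun setT p) (p1 : forall x, 1 <= p x).

Lemma inve_exponent x : (p x)^-1 = (fine ((p x)^-1))%:E.
Proof.
case: (p x) (p1 x) => [v| |]//; rewrite lee_fin => v1.
by rewrite inver gt_eqF// (lt_le_trans ltr01).
Qed.

Lemma inve_exponent01 x : (0 <= fine ((p x)^-1) <= 1)%R.
Proof.
case: (p x) (p1 x) => [v| |]//; last by rewrite /= lexx ler01.
rewrite lee_fin => v1; have v0 : (0 < v)%R by exact: lt_le_trans v1.
by rewrite inver gt_eqF//= invr_ge0 ltW// invf_le1.
Qed.

Lemma measurable_inve_exponent : measurable_fun setT (fun x => fine ((p x)^-1)).
Proof.
(* At [p x = +oo], [fine] gives 0 and the power -1 of 0 is 0, in agreement with 1/oo = 0. *)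
rewrite (_ : (fun x => _) = (fun x => fine (p x) `^ (-1))%R); last first.
  apply/funext => x; case: (p x) (p1 x) => [v| |]//=.
    rewrite lee_fin => v1; have v0 : (0 < v)%R by exact: lt_le_trans v1.
    by rewrite inver gt_eqF//= powR_inv1// ltW.
  by rewrite powR0// oppr_eq0 oner_eq0.
by apply: (measurableT_comp (measurable_powR _)); exact: measurableT_comp.
Qed.

Lemma inve_exponent_bounds (P eta : R) : (1 < P)%R -> (0 <= eta)%R ->
  P%:E <= ess_inf mu p -> ess_sup mu p <= (eta%:E)^-1 ->
  LH0 d (fun x => fine ((p x)^-1)) ->
  forall x, (eta <= fine ((p x)^-1) <= P^-1)%R.
Proof.
move=> P1 eta0 pP peta lh x; have P0 : (0 < P)%R by exact: lt_trans P1.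
apply/andP; split.
- move: x; apply: (LH0_ae_ge hX lh).
  apply: filterS (ess_sup_ge mu p) => x px.
  have [->|etaN0] := eqVneq eta 0%R; first by have /andP[] := inve_exponent01 x.
  have {}eta0 : (0 < eta)%R by rewrite lt_def etaN0.
  have := le_trans px peta; rewrite inver (negbTE etaN0).
  case: (p x) (p1 x) => [v| |]//; rewrite !lee_fin => v1 veta.
  have v0 : (0 < v)%R by exact: lt_le_trans v1.
  by rewrite inver gt_eqF//= -[leLHS]invrK lef_pV2 ?posrE ?invr_gt0.
- move: x; apply: (LH0_ae_le hX lh).
  apply: filterS (ess_inf_le mu p) => x px.
  have := le_trans pP px.
  case: (p x) (p1 x) => [v| |]//; last by move=> _ _; rewrite /= invr_ge0 ltW.
  rewrite !lee_fin => v1 Pv; have v0 : (0 < v)%R by exact: lt_le_trans v1.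
  by rewrite inver gt_eqF//= lef_pV2 ?posrE.
Qed.

End Exponent.

Theorem theorem1p1 (R : realType) (disp : measure_display)
    (X : measurableType disp) (d : X -> X -> R)
    (mu : {measure set X -> \bar R}) (hX : homogeneous_type d mu) (x0 : X)
    (eta : R) (heta : (0 <= eta < 1)%R)
    (p : X -> \bar R) (mp : measurable_fun setT p) (p1 : forall x, 1 <= p x)
    (pminus : 1 < ess_inf mu p) (pminusplus : ess_inf mu p <= ess_sup mu p)
    (pplus : ess_sup mu p <= (eta%:E)^-1)
    (q : X -> \bar R) (hq : forall x, (p x)^-1 - (q x)^-1 = eta%:E) :
  (LH d x0 (fun x => fine ((p x)^-1)) ->
    exists C : R, forall f, var_Lp mu p f ->
      var_norm mu q (frac_maximal d mu eta f) <= C%:E * var_norm mu p f)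
  /\
  (mu setT < +oo -> LH0 d (fun x => fine ((p x)^-1)) ->
    exists C : R, forall f, var_Lp mu p f ->
      var_norm mu q (frac_maximal d mu eta f) <= C%:E * var_norm mu p f).
Proof.
have /andP[eta0 eta1] := heta.
pose r x := fine ((p x)^-1).
have pE x : (p x)^-1 = (r x)%:E := inve_exponent p1 x.
(* If [p_-] is infinite, any real above 1 will do. *)
have [P P1 Pp] : exists2 P : R, (1 < P)%R & P%:E <= ess_inf mu p.
  case: (ess_inf mu p) pminus => [v| |]// h; first by exists v.
  by exists 2%R; [rewrite ltr1n|rewrite leey].
have qE x : (q x)^-1 = (r x - eta)%:E.
  have := hq x; rewrite pE; case: ((q x)^-1) => [v| |]//= [<-].
  by congr (_%:E); ring.
have main : LH d x0 r -> exists C : R, forall f, var_Lp mu p f ->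
    var_norm mu q (frac_maximal d mu eta f) <= C%:E * var_norm mu p f.
  move=> lh; have rP := inve_exponent_bounds hX p1 P1 eta0 Pp pplus lh.1.
  have [C C0 mod] := modular_frac_maximal hX P1 heta
    (measurable_inve_exponent mp p1) rP lh pE qE.
  exists C => f [mf _]; apply: var_norm_frac_maximal => // l l0.
  exact: mod.
split=> // muT lh; apply: main; split=> //.
apply: (finite_measure_LH_infty hX) => // x; exact: inve_exponent01.
Qed.
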